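(* Let $M^n$ be connected and let $F:M^n\to\mathcal{L}^{2n-1,1}$ be a flat immersion with flat non-degenerate normal bundle and curvature normals $v_1,\dots,v_n$, numbered so that $(v_n,v_n)<0$. Let $(x_1,\dots,x_n)$ be a line of curvature co-ordinate system on $M$ (with $\partial/\partial x_i$ in the curvature direction of $v_i$), with induced metric $\mathrm{I}_F=\sum_{i=1}^nh_i^2\,dx_i^2$, $h_i>0$, normalised so that $h_i^2\,|(v_i,v_i)|=1$ for all $i$. Let $\Psi=(\mathbf{e}_1,\dots,\mathbf{e}_n,\mathbf{u}_1,\dots,\mathbf{u}_n)$ be the $\mathrm{O}(2n-1,1)$-frame of principal curvature directions $\mathbf{e}_i=h_i^{-1}F_{x_i}$ and normals $\mathbf{u}_i=h_iv_i$ parallel to the curvature normals. Define $\xi=(\xi_{ij})$ by $$\xi_{ij}=\frac{(h_i)_{x_j}}{h_j}\ (i\ne j),\qquad \xi_{ii}=0,$$ and put $J=\mathrm{I}_{n-1,1}$, $a_i=\begin{pmatrix}0&-e_{ii}J\\ e_{ii}&0\end{pmatrix}$ for $1\le i\le n$. Then: (a) $\Xi:=\begin{pmatrix}0&\xi^T\\ -J\xi&0\end{pmatrix}$ is a solution of the $U/K$-system defined by $\mathfrak{a}$: $$[a_i,\Xi_{x_j}]-[a_j,\Xi_{x_i}]-[[a_i,\Xi],[a_j,\Xi]]=0,\qquad i\ne j;$$ (b) $\Psi^{-1}d\Psi=\sum_{i=1}^n(a_i+[a_i,\Xi])\,dx_i$; (c) if $g=\begin{pmatrix}g_1&0\\ 0&g_2\end{pmatrix}$,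 with values in $K$, is a solution of $g^{-1}dg=\sum_{i=1}^n[a_i,\Xi]\,dx_i$, then there exists a constant null vector $\mathbf{c}\in\mathbb{R}^{n-1,1}$ such that $F=\Psi\begin{pmatrix}0\\ g_2^{-1}\mathbf{c}\end{pmatrix}$.
   Context: $\mathrm{I}_{m,1}=\operatorname{diag}(1,\dots,1,-1)$ (size $m+1$); $\mathbb{R}^{m,1}$ is $\mathbb{R}^{m+1}$ with $(x,y)=x^T\mathrm{I}_{m,1}y$; $\mathcal{L}^{2n-1,1}=\{x\in\mathbb{R}^{2n-1,1}:(x,x)=0\}$. $F$ flat means its induced metric $\mathrm{I}_F=(dF,dF)$ is positive definite and flat. The normal bundle $N_F$ is the orthogonal complement of the tangent bundle in $M\times\mathbb{R}^{2n-1,1}$; it is flat if the normal connection is flat and non-degenerate if at each point the space of shape operators $A_v$ ($A_v$ = tangential part of $-dv$) has dimension $n$. In that case there are $n$ rank-one curvature distributions $E_i$ (common eigenspaces of all shape operators) with curvature normals $v_i$ defined by $A_v|_{E_i}=(v,v_i)\operatorname{Id}$; they are mutually orthogonal and non-isotropic and exactly one is time-like. Line of curvature co-ordinates are co-ordinates with $\partial/\partial x_i\in E_i$. $U=\mathrm{O}(2n-1,1)=\{g:g^T\mathrm{I}_{2n-1,1}g=\mathrm{I}_{2n-1,1}\}$ and $K=\mathrm{O}(n)\times\mathrm{O}(n-1,1)$ (block diagonal, blocks of size $n$). The Cartan decomposition is $\mathfrak{u}=\mathfrak{k}+\mathfrak{p}$ with $\mathfrak{k}=\mathfrak{o}(n)\times\mathfrak{o}(n-1,1)$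 and $\mathfrak{p}=\left\{\begin{pmatrix}0&\eta^TJ\\ -\eta&0\end{pmatrix}:\eta\in\mathfrak{gl}(n)\right\}$. $\mathfrak{a}=\left\{\begin{pmatrix}0&DJ\\ -D&0\end{pmatrix}:D\text{ diagonal}\right\}$ is a maximal abelian subalgebra (Cartan subalgebra) of $\mathfrak{p}$ with basis $a_1,\dots,a_n$; $\mathfrak{a}^\perp$ is its orthogonal complement for the Killing form. A solution of the $U/K$-system is a map $\Xi$ with values in $\mathfrak{a}^\perp\cap\mathfrak{p}$ satisfying the displayed system. $e_{ii}$ is the elementary $n\times n$ matrix. *)

(* Defs.v *)
From HB Require Import structures.
From mathcomp Require Import all_boot all_order all_algebra.
From mathcomp Require Import all_classical all_reals all_analysis.
Set Implicit Arguments.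
Unset Strict Implicit.
Unset Printing Implicit Defensive.
Import Order.TTheory GRing.Theory Num.Theory.
Import numFieldNormedType.Exports.
Local Open Scope classical_set_scope.
Local Open Scope ring_scope.

(* A manifold carrying a global co-ordinate system x = (x_1, ..., x_n) is
   identified with the open set [Om] of R^n that x takes as its values.  Points
   and tangent vectors are column vectors, so d/dx_i is [delta_mx i 0] and
   dx_i(w) is [w i 0].  Values of maps outside [Om] are irrelevant. *)

Section Calculus.
Variables (R : realType) (n : nat).
Implicit Types (Om : set 'cV[R]_n) (x : 'cV[R]_n).

Definition partial (W : normedModType R) (i : 'I_n) (f : 'cV[R]_n -> W) x : W :=
  'D_(delta_mx i 0) f x.

Fixpoint Ck (W : normedModType R) Om (k : nat) (f : 'cV[R]_n -> W) : Prop :=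
  if k is k'.+1 then
    (forall x, Om x -> differentiable f x) /\
    (forall i : 'I_n, Ck Om k' (partial i f))
  else forall x, Om x -> {for x, continuous f}.

Definition smooth (W : normedModType R) Om (f : 'cV[R]_n -> W) : Prop :=
  forall k, Ck Om k f.

(* [g] solves g^-1 dg = \sum_i theta_i dx_i on [Om]. *)
Definition solves_log_derivative (N : nat) Om (g : 'cV[R]_n -> 'M[R]_N)
    (theta : 'I_n -> 'cV[R]_n -> 'M[R]_N) : Prop :=
  forall x, Om x ->
    [/\ g x \in unitmx, differentiable g x &
        forall w : 'cV[R]_n,
          invmx (g x) *m 'd g x w = \sum_(i < n) w i 0 *: theta i x].

Definition christoffel (g : 'cV[R]_n -> 'M[R]_n) (k i j : 'I_n) x : R :=
  2^-1 * \sum_(l < n) invmx (g x) k l *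
    (partial i (fun y => g y j l : R) x + partial j (fun y => g y i l : R) x
     - partial l (fun y => g y i j : R) x).

(* The component R^l_kij of the curvature of the Levi-Civita connection, where
   R(d_i, d_j) d_k = \sum_l R^l_kij d_l. *)
Definition riemann (g : 'cV[R]_n -> 'M[R]_n) (l k i j : 'I_n) x : R :=
  partial i (christoffel g l j k) x - partial j (christoffel g l i k) x
  + \sum_(p < n) (christoffel g p j k x * christoffel g l i p x
                  - christoffel g p i k x * christoffel g l j p x).

Definition flat_metric Om (g : 'cV[R]_n -> 'M[R]_n) : Prop :=
  forall x, Om x -> forall l k i j, riemann g l k i j x = 0.

End Calculus.

Section LinearAlgebra.
Variable R : realType.

(* diag(1, ..., 1, -1), of size k. *)
Definition Imink (k : nat) : 'M[R]_k :=
  diag_mx (\row_(j < k) (if j.+1 == k then -1 else 1)).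

Definition mink (k : nat) (x y : 'cV[R]_k) : R := (x^T *m Imink k *m y) 0 0.

Definition orthogonal_group (k : nat) : set 'M[R]_k :=
  [set A | A^T *m A = 1%:M].

Definition lorentz_group (k : nat) : set 'M[R]_k :=
  [set A | A^T *m Imink k *m A = Imink k].

Definition has_dim (W : vectType R) (S : set W) (d : nat) : Prop :=
  exists V : {vspace W}, (forall X, X \in V <-> S X) /\ \dim V = d.

Definition lie (k : nat) (A B : 'M[R]_k) : 'M[R]_k := A *m B - B *m A.

(* The Lie algebra of [lorentz_group k]. *)
Definition lorentz_algebra (k : nat) : {vspace 'M[R]_k} :=
  lker (linfun (fun X : 'M[R]_k => X^T *m Imink k + Imink k *m X)).

Lemma lorentz_algebraP (k : nat) (X : 'M[R]_k) :
  (X \in lorentz_algebra k) = (X^T *m Imink k + Imink k *m X == 0).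
Proof.
have lin : linear (fun X : 'M[R]_k => X^T *m Imink k + Imink k *m X).
  move=> c A B; rewrite [(_ + _)^T]linearP /= mulmxDl mulmxDr.
  by rewrite -scalemxAl -scalemxAr scalerDr addrACA.
pose lf := GRing.isLinear.Build _ _ _ _ _ lin.
pose f : {linear 'M[R]_k -> 'M[R]_k} := HB.pack (fun X : 'M[R]_k =>
  X^T *m Imink k + Imink k *m X) lf.
by rewrite memv_ker -[linfun _]/(linfun f) lfunE.
Qed.

Definition trace_on (W : vectType R) (V : {vspace W}) (f : W -> W) : R :=
  \sum_(i < \dim V) coord (vbasis V) i (f (vbasis V)`_i).

(* Killing form of [lorentz_algebra k]. *)
Definition killing (k : nat) (X Y : 'M[R]_k) : R :=
  trace_on (lorentz_algebra k) (fun Z => lie X (lie Y Z)).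

End LinearAlgebra.

Section UKSystem.
Variables (R : realType) (n : nat).
Local Notation J := (Imink R n).

Definition p_space : set 'M[R]_(n + n) :=
  [set X | exists eta : 'M[R]_n, X = block_mx 0 (eta^T *m J) (- eta) 0].

Definition a_space : set 'M[R]_(n + n) :=
  [set X | exists d : 'rV[R]_n,
     X = block_mx 0 (diag_mx d *m J) (- diag_mx d) 0].

Definition a_perp : set 'M[R]_(n + n) :=
  [set X | X \in lorentz_algebra R (n + n) /\
           forall Y, a_space Y -> killing X Y = 0].

Definition a_basis (i : 'I_n) : 'M[R]_(n + n) :=
  block_mx 0 (- (delta_mx i i *m J)) (delta_mx i i) 0.

Definition UK_solution (Om : set 'cV[R]_n) (Xi : 'cV[R]_n -> 'M[R]_(n + n)) :
    Prop :=
  [/\ smooth Om Xi,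
      forall x, Om x -> p_space (Xi x) /\ a_perp (Xi x) &
      forall x, Om x -> forall i j : 'I_n, i != j ->
        lie (a_basis i) (partial j Xi x) - lie (a_basis j) (partial i Xi x)
        - lie (lie (a_basis i) (Xi x)) (lie (a_basis j) (Xi x)) = 0].

End UKSystem.

Section Immersions.
Variables (R : realType) (n : nat) (Om : set 'cV[R]_n).
Variable F : 'cV[R]_n -> 'cV[R]_(n + n).
Implicit Types (x X : 'cV[R]_n) (N : 'cV[R]_n -> 'cV[R]_(n + n)).

(* The matrix of dF, with columns the partial derivatives of F. *)
Definition jac x : 'M[R]_(n + n, n) := \matrix_(a, i) partial i F x a 0.

Definition metric x : 'M[R]_n := (jac x)^T *m Imink R (n + n) *m jac x.

Definition flat_immersion : Prop :=
  (forall x, Om x -> forall w : 'cV[R]_n, w != 0 ->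
     0 < (w^T *m metric x *m w) 0 0) /\
  flat_metric Om metric.

Definition normal_vector x (y : 'cV[R]_(n + n)) : Prop :=
  forall i, mink (partial i F x) y = 0.

Definition normal_field N : Prop :=
  smooth Om N /\ forall x, Om x -> normal_vector x (N x).

(* When [metric x] is invertible, [jac x *m tangent_part x y] is the orthogonal
   projection of y onto the tangent space, so [tangent_part x y] is the
   tangential part of y as a tangent vector of [Om]. *)
Definition tangent_part x (y : 'cV[R]_(n + n)) : 'cV[R]_n :=
  invmx (metric x) *m ((jac x)^T *m Imink R (n + n) *m y).

Definition normal_part x (y : 'cV[R]_(n + n)) : 'cV[R]_(n + n) :=
  y - jac x *m tangent_part x y.

Definition normal_connection (i : 'I_n) N x : 'cV[R]_(n + n) :=
  normal_part x (partial i N x).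

(* Vanishing curvature of the normal connection; the co-ordinate fields
   commute. *)
Definition flat_normal_bundle : Prop :=
  forall N, normal_field N -> forall x, Om x -> forall i j : 'I_n,
    normal_connection i (normal_connection j N) x =
    normal_connection j (normal_connection i N) x.

(* The matrix, in the basis d/dx_i, of the shape operator A_N at x. *)
Definition shape N x : 'M[R]_n :=
  \matrix_(k, j) - tangent_part x (partial j N x) k 0.

Definition nondegenerate_normal_bundle : Prop :=
  forall x, Om x ->
    has_dim [set A | exists2 N, normal_field N & A = shape N x] n.

(* The common eigenspace at x of all shape operators, with A_N having
   eigenvalue (N, v). *)
Definition curvature_distribution (v : 'cV[R]_(n + n)) x : set 'cV[R]_n :=
  [set X | forall N, normal_field N ->
     shape N x *m X = mink (N x) v *: X].

Definition curvature_normals (v : 'I_n -> 'cV[R]_n -> 'cV[R]_(n + n)) : Prop :=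
  forall x, Om x -> forall i,
    normal_vector x (v i x) /\
    has_dim (curvature_distribution (v i x) x) 1.

(* The identity co-ordinates of [Om] are line of curvature co-ordinates, with
   d/dx_i in the curvature direction of v_i. *)
Definition line_of_curvature_coordinates
    (v : 'I_n -> 'cV[R]_n -> 'cV[R]_(n + n)) : Prop :=
  forall x, Om x -> forall i,
    curvature_distribution (v i x) x (delta_mx i 0).

Definition frame (h : 'I_n -> 'cV[R]_n -> R)
    (v : 'I_n -> 'cV[R]_n -> 'cV[R]_(n + n)) x : 'M[R]_(n + n) :=
  row_mx (\matrix_(a, i) ((h i x)^-1 *: partial i F x) a 0)
         (\matrix_(a, i) (h i x *: v i x) a 0).

End Immersions.

Section Xi.
Variables (R : realType) (n : nat) (h : 'I_n -> 'cV[R]_n -> R).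

Definition xi (x : 'cV[R]_n) : 'M[R]_n :=
  \matrix_(i, j) if i == j then 0 else partial j (h i) x / h j x.

Definition Xi (x : 'cV[R]_n) : 'M[R]_(n + n) :=
  block_mx 0 (xi x)^T (- (Imink R n *m xi x)) 0.

End Xi.

(* Main.v *)
From HB Require Import structures.
Require Import Defs.
From mathcomp Require Import all_boot all_order all_algebra.
From mathcomp Require Import all_classical all_reals all_analysis.
From mathcomp Require Import ring lra.
Import Order.TTheory GRing.Theory Num.Theory.
Import numFieldNormedType.Exports.
Local Open Scope classical_set_scope.
Local Open Scope ring_scope.
Set Implicit Arguments.
Unset Strict Implicit.
Unset Printing Implicit Defensive.

(** The argument is the method of moving frames.  Write F_i, F_ij for the
    partial derivatives of F, (.,.) for the Lorentzian form, [e_i = F_i / h_i]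
    and [u_i = h_i v_i].

    Since (F_i, F_j) is diagonal with entries h_i^2, the Koszul identity gives
    every product (F_ij, F_l) in terms of the h_i (lemma [mink_ddF]).  Because
    the co-ordinates are line of curvature co-ordinates, the normal part of F_ij
    vanishes for i <> j and equals h_i^2 v_i for i = j ([mink_ddF_normal]; every
    normal vector extends to a smooth normal field, namely the normal part of a
    constant).  So v_i = h_i^-2 (F_ii)^perp is smooth, and the Gauss equation
    turns the flatness of the metric into (v_i, v_j) = 0 for i <> j
    ([curvature_normals_orthogonal]).  Two orthogonal vectors cannot both be
    time-like, so the normalisation of the h_i makes the frame Psi Lorentzian
    ([mink_normal_dir], [frame_lorentz]).

    The products of the frame vectors with their derivatives are then computed
    one block at a time.  Only the derivatives of the u_i inside the normal
    bundle need more than the above; they come from the Codazzi equation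
    ([mink_normal_dnormal_neq]).  Together they say that the derivative of Psi
    in the direction j is Psi (a_j + [a_j, Xi]), which is (b)
    ([partial_frame]).

    For (a), the symmetry of the second derivatives of Psi gives the zero
    curvature equation of this connection, and since a_i a_j = 0 for i <> j it
    reduces to the equation of the U/K-system ([Xi_UK_equation]).  Orthogonality
    of Xi to the Cartan subalgebra needs no formula for the Killing form: it is
    invariant under conjugation by the matrices S_k = diag(s, s), where s changes
    the k-th sign; these conjugations fix the Cartan subalgebra, and the
    differences Xi - S_k Xi S_k add up to 4 Xi ([killing_off_diagonal]).

    For (c), F is itself a normal vector, because (F, F) = 0.  Write
    F = Psi y; the tangential half of y vanishes.  Differentiating this equation
    in the direction i and using (b) shows that y_i + [a_i, Xi] y has neither a
    tangential nor a normal half, hence vanishes ([parallel_frame_coord]).  So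
    g y is constant on the connected domain; its normal half is the vector c
    ([position_constant]). *)

(** * Partial derivatives and smooth maps *)

(** A copy of the partial derivative [partial] that does not unfold.  Comparing
    two different derivatives of matrix entries up to conversion would otherwise
    descend to the limits that define them. *)
HB.lock Definition pd {R : realType} {n : nat} {W : normedModType R} (i : 'I_n)
  (f : 'cV[R]_n -> W) (x : 'cV[R]_n) : W := partial i f x.

Lemma pdE {R : realType} {n : nat} {W : normedModType R} (i : 'I_n)
  (f : 'cV[R]_n -> W) : partial i f = pd i f.
Proof. by rewrite pd.unlock. Qed.

Lemma CkSP {R : realType} {n : nat} {W : normedModType R} (Om : set 'cV[R]_n) k
    (f : 'cV[R]_n -> W) :
  Ck Om k.+1 f <->
  (forall x, Om x -> differentiable f x) /\ (forall i, Ck Om k (pd i f)).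
Proof. by split=> -[df Cf]; split=> // i; have := Cf i; rewrite pdE. Qed.

Lemma Ck_partial {R : realType} {n : nat} {W : normedModType R}
    (Om : set 'cV[R]_n) k (f : 'cV[R]_n -> W) :
  Ck Om k.+1 f -> forall i, Ck Om k (pd i f).
Proof. by case/CkSP. Qed.

Section NearEq.
Context {R : realType} {V W : normedModType R}.

Lemma differentiable_near_eq (f g : V -> W) (x : V) :
  (\forall z \near x, f z = g z) -> differentiable f x -> differentiable g x.
Proof.
move=> fg df.
have fx : f x = g x by exact: nbhs_singleton fg.
have dfc := diff_continuous df.
have H : g \o shift x = cst (g x) + 'd f x +o_ 0 id.
  apply/eqaddoP => e e0.
  have fg0 : \forall z \near 0, f (z + x) = g (z + x).
    by move: fg; rewrite (near_shift 0) subr0.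
  have /eqaddoP /(_ e e0) := diff_locally df.
  apply: filterS2 fg0 => y fgy; rewrite !fctE /= fgy fx; exact.
apply/diff_locallyP; rewrite (diff_unique dfc H); split => //.
Qed.

End NearEq.

Section Calculus.
Context {R : realType} {n : nat} {Om : set 'cV[R]_n}.
Hypothesis Om_open : open Om.
Implicit Types (x : 'cV[R]_n).

Lemma near_Om x : Om x -> \forall z \near x, Om z.
Proof. by move=> Ox; exact: open_nbhs_nbhs. Qed.

Section Normed.
Context {W : normedModType R}.
Implicit Types (f g : 'cV[R]_n -> W).

Lemma near_eq_on f g x : (forall z, Om z -> f z = g z) -> Om x ->
  \forall z \near x, f z = g z.
Proof. by move=> fg Ox; apply: filterS (near_Om Ox) => z; exact: fg. Qed.

Lemma eq_partial f g i x : (forall z, Om z -> f z = g z) -> Om x ->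
  pd i f x = pd i g x.
Proof. by move=> fg Ox; rewrite -!pdE; apply: near_eq_derive; exact: near_eq_on. Qed.

Lemma eq_differentiable f g x : (forall z, Om z -> f z = g z) -> Om x ->
  differentiable f x -> differentiable g x.
Proof. by move=> fg Ox; apply: differentiable_near_eq; exact: near_eq_on. Qed.

Lemma eq_Ck k f g : (forall z, Om z -> f z = g z) -> Ck Om k f -> Ck Om k g.
Proof.
elim: k f g => [|k IH] f g fg /= Cf.
  move=> x Ox; have cf := Cf x Ox.
  have near_fg := near_eq_on fg Ox.
  rewrite /prop_for /continuous_at -(fg x Ox); apply: cvg_trans cf.
  exact: near_eq_cvg near_fg.
apply/CkSP; split=> [x Ox|i]; first exact: eq_differentiable fg Ox (Cf.1 x Ox).
by apply: IH (Ck_partial Cf i) => z Oz; exact: eq_partial.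
Qed.

Lemma CkS k f : Ck Om k.+1 f -> Ck Om k f.
Proof.
elim: k f => [|k IH] f Cf.
  by move=> x Ox; apply: differentiable_continuous; exact: Cf.1.
apply/CkSP; split=> [|i]; first exact: Cf.1.
by apply: IH; exact: Ck_partial.
Qed.

Lemma partialE f i x : differentiable f x -> pd i f x = 'd f x (delta_mx i 0).
Proof. by move=> df; rewrite pd.unlock /partial deriveE. Qed.

Lemma partialD f g i x : differentiable f x -> differentiable g x ->
  pd i (fun y => f y + g y) x = pd i f x + pd i g x.
Proof.
by move=> df dg; rewrite pd.unlock /partial -deriveD //; exact: diff_derivable.
Qed.

Lemma partialN f i x : differentiable f x ->
  pd i (fun y => - f y) x = - pd i f x.
Proof. by move=> df; rewrite pd.unlock /partial -deriveN //; exact: diff_derivable. Qed.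

Lemma partial_sum q (f : 'I_q -> 'cV[R]_n -> W) i x :
  (forall k, differentiable (f k) x) ->
  pd i (\sum_(k < q) f k) x = \sum_(k < q) pd i (f k) x.
Proof.
by move=> df; rewrite pd.unlock /partial derive_sum // => k; exact: diff_derivable.
Qed.

Lemma partial_cst (c : W) i x : pd i (fun=> c) x = 0.
Proof. by rewrite pd.unlock /partial derive_cst. Qed.

Lemma smooth_differentiable f x : smooth Om f -> Om x -> differentiable f x.
Proof. by move=> /(_ 1%N) [df _]; exact: df. Qed.

Lemma smooth_partial f i : smooth Om f -> smooth Om (pd i f).
Proof. by move=> sf k; case/CkSP: (sf k.+1) => _; exact. Qed.

Lemma eq_smooth f g : (forall z, Om z -> f z = g z) -> smooth Om f -> smooth Om g.
Proof. by move=> fg sf k; exact: eq_Ck (sf k). Qed.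

Lemma smooth_cst (c : W) : smooth Om (fun=> c).
Proof.
move=> k; elim: k c => [|k IH] c; first by move=> x _; exact: cst_continuous.
apply/CkSP; split=> [x _|i]; first exact: differentiable_cst.
by apply: eq_Ck (IH 0) => x _; rewrite partial_cst.
Qed.

Lemma CkD k f g : Ck Om k f -> Ck Om k g -> Ck Om k (fun x => f x + g x).
Proof.
elim: k f g => [|k IH] f g Cf Cg /=.
  by move=> x Ox; apply: continuousD; [exact: Cf | exact: Cg].
apply/CkSP; split=> [x Ox|i].
  by apply: differentiableD; [exact: Cf.1 | exact: Cg.1].
apply: eq_Ck (IH _ _ (Ck_partial Cf i) (Ck_partial Cg i)) => x Ox.
by rewrite partialD //; [exact: Cf.1 | exact: Cg.1].
Qed.

Lemma smoothD f g : smooth Om f -> smooth Om g -> smooth Om (fun x => f x + g x).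
Proof. by move=> sf sg k; exact: CkD. Qed.

Lemma smooth_sum (I : Type) (r : seq I) (P : pred I) (f : I -> 'cV[R]_n -> W) :
  (forall i, smooth Om (f i)) -> smooth Om (fun x => \sum_(i <- r | P i) f i x).
Proof.
move=> sf; elim: r => [|i r IH].
  by apply: eq_smooth (smooth_cst 0) => x _; rewrite big_nil.
case Pi : (P i); last by apply: eq_smooth IH => x _; rewrite big_cons Pi.
by apply: eq_smooth (smoothD (sf i) IH) => x _; rewrite big_cons Pi.
Qed.

End Normed.

Section Scalar.
Implicit Types (f g : 'cV[R]_n -> R).

Lemma partialM f g i x : differentiable f x -> differentiable g x ->
  pd i (fun y => f y * g y) x = pd i f x * g x + f x * pd i g x.
Proof.
move=> df dg; rewrite pd.unlock /partial -[fun y => _]/(f * g).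
rewrite deriveM; [|exact: diff_derivable..].
by rewrite addrC; congr (_ + _); rewrite /= mulrC.
Qed.

Lemma CkM k f g : Ck Om k f -> Ck Om k g -> Ck Om k (fun x => f x * g x).
Proof.
elim: k f g => [|k IH] f g Cf Cg /=.
  by move=> x Ox; apply: continuousM; [exact: Cf | exact: Cg].
apply/CkSP; split=> [x Ox|i].
  by apply: differentiableM; [exact: Cf.1 | exact: Cg.1].
have H : Ck Om k (fun x => pd i f x * g x + f x * pd i g x).
  by apply: CkD; apply: IH; [exact: Ck_partial|exact: CkS|exact: CkS|exact: Ck_partial].
apply: eq_Ck H => x Ox.
by rewrite partialM //; [exact: Cf.1 | exact: Cg.1].
Qed.

Lemma smoothM f g : smooth Om f -> smooth Om g -> smooth Om (fun x => f x * g x).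
Proof. by move=> sf sg k; exact: CkM. Qed.

Lemma smoothN f : smooth Om f -> smooth Om (fun x => - f x).
Proof.
move=> sf.
apply: (@eq_smooth _ (fun x => -1 * f x)) (smoothM (smooth_cst (-1 : R)) sf) => x _.
by rewrite mulN1r.
Qed.

Lemma partialV f i x : differentiable f x -> f x != 0 ->
  pd i (fun y => (f y)^-1) x = - (pd i f x * ((f x)^-1 * (f x)^-1)).
Proof.
move=> df fx0; rewrite pd.unlock /partial deriveV //; last exact: diff_derivable.
by rewrite -expr2 exprVn mulrC scaleNr.
Qed.

Lemma CkV k f : Ck Om k f -> (forall x, Om x -> f x != 0) ->
  Ck Om k (fun x => (f x)^-1).
Proof.
move=> + f0; elim: k => [|k IH] Cf.
  by move=> x Ox; apply: continuousV; [exact: f0 | exact: Cf].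
have df := Cf.1.
apply/CkSP; split=> [x Ox|i]; first by apply: differentiableV; [exact: df | exact: f0].
have H : Ck Om k (fun x => -1 * (pd i f x * ((f x)^-1 * (f x)^-1))).
  apply: CkM; first exact: smooth_cst.
  by apply: CkM; [exact: Ck_partial | apply: CkM; apply/IH/CkS].
apply: eq_Ck H => x Ox; rewrite partialV ?mulN1r //; last exact: f0.
exact: df.
Qed.

Lemma smoothV f : smooth Om f -> (forall x, Om x -> f x != 0) ->
  smooth Om (fun x => (f x)^-1).
Proof. by move=> sf f0 k; exact: CkV. Qed.

(** The square root of a smooth positive function is smooth, stated for a
    function whose square is known to be smooth; its partial derivatives are
    those of the square divided by twice the function. *)
Lemma smooth_sqrt f : (forall x, Om x -> 0 < f x) ->
  smooth Om (fun x => f x ^+ 2) -> smooth Om f.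
Proof.
move=> f0 sf2.
have df x : Om x -> differentiable f x.
  move=> Ox; pose g (y : 'cV[R]_n) := Num.sqrt (f y ^+ 2).
  have gf z : Om z -> g z = f z.
    by move=> Oz; rewrite /g sqrtr_sqr gtr0_norm // f0.
  apply: (eq_differentiable gf Ox).
  apply: (@differentiable_comp _ _ _ _ (fun y => f y ^+ 2) (@Num.sqrt R)).
    exact: smooth_differentiable.
  apply/derivable1_diffP; apply: (@ex_derive _ _ _ _ _ _ _ (is_derive1_sqrt _)).
  by rewrite exprn_gt0 // f0.
have pf i x : Om x -> 2^-1 * (pd i (fun x => f x ^+ 2) x * (f x)^-1) = pd i f x.
  move=> Ox; rewrite (_ : (fun x => f x ^+ 2) = (fun x => f x * f x)); last first.
    by apply/funext => y; rewrite expr2.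
  rewrite partialM; [|exact: df|exact: df].
  have f0' := lt0r_neq0 (f0 x Ox).
  by field.
elim=> [|k IH]; first by move=> x Ox; exact/differentiable_continuous/df.
apply/CkSP; split=> [|i]; first exact: df.
apply: eq_Ck (pf i) _; apply: CkM; first exact: smooth_cst.
apply: CkM; first exact: smooth_partial.
by apply: CkV => // x Ox; exact/lt0r_neq0/f0.
Qed.

End Scalar.

Section Matrices.
Context {p q : nat}.
Implicit Types (A B : 'cV[R]_n -> 'M[R]_(p, q)).

Lemma differentiable_mxP A x :
  differentiable A x <-> forall i j, differentiable (fun y => A y i j : R) x.
Proof.
split=> [dA i j|dA].
  exact: (@differentiable_comp _ _ _ _ A (fun N : 'M[R]_(p, q) => N i j : R) x
    dA (differentiable_coord _ _ _)).
rewrite (_ : A = \sum_(i < p) \sum_(j < q) (fun y => A y i j *: delta_mx i j)); last first.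
  apply/funext => y; rewrite fct_sumE {1}(matrix_sum_delta (A y)).
  by apply: eq_bigr => i _; rewrite fct_sumE.
apply: differentiable_sum => i; apply: differentiable_sum => j.
exact: differentiableZl.
Qed.

Lemma partial_mx A k x i j : differentiable A x ->
  pd k A x i j = pd k (fun y => A y i j : R) x.
Proof. by move=> dA; rewrite pd.unlock /partial derive_mx ?mxE //; exact: diff_derivable. Qed.

Lemma Ck_mxP k A :
  Ck Om k A <-> forall i j, Ck Om k (fun y => A y i j : R).
Proof.
elim: k A => [|k IH] A.
  split=> [cA i j x Ox|cA x Ox].
    apply: (@continuous_comp _ _ _ A (fun N : 'M[R]_(p, q) => N i j : R)).
      exact: cA.
    exact: coord_continuous.
  rewrite /prop_for /continuous_at; apply/(@cvgrPdist_lt _ _ _ (nbhs x) (nbhs_filter x)) => e e0.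
  have H : \forall y \near x, forall ij : 'I_p * 'I_q,
      `|A x ij.1 ij.2 - A y ij.1 ij.2| < e.
    apply: (@filter_forall _ _ _ (nbhs x) (nbhs_filter x)) => -[i j] /=.
    by move/(@cvgrPdist_lt _ _ _ (nbhs x) (nbhs_filter x)): (cA i j x Ox); exact.
  apply: filterS H => y Hy; rewrite [ltLHS]/Num.Def.normr/= mx_normrE.
  by apply: bigmax_lt => // ij _; rewrite !mxE; exact: Hy.
split=> [/CkSP[dA CA] i j|CA].
  apply/CkSP; split=> [x Ox|l]; first by move/differentiable_mxP: (dA x Ox); exact.
  apply: eq_Ck ((IH _).1 (CA l) i j) => x Ox.
  by rewrite partial_mx //; exact: dA.
have dA x : Om x -> differentiable A x.
  by move=> Ox; apply/differentiable_mxP => i j; exact: (CA i j).1.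
apply/CkSP; split=> // l; apply/IH => i j; apply: eq_Ck (Ck_partial (CA i j) l) => x Ox.
by rewrite partial_mx //; exact: dA.
Qed.

Lemma smooth_mxP A :
  smooth Om A <-> forall i j, smooth Om (fun y => A y i j : R).
Proof.
split=> [sA i j k|sA k]; first exact: (Ck_mxP k A).1.
by apply/Ck_mxP => i j; exact: sA.
Qed.

End Matrices.

Section MatrixProduct.
Context {p q r : nat}.
Variables (A : 'cV[R]_n -> 'M[R]_(p, q)) (B : 'cV[R]_n -> 'M[R]_(q, r)).

Let mulmx_entry i j :
  (fun y => (A y *m B y) i j : R) = \sum_(k < q) (fun y => A y i k * B y k j).
Proof. by apply/funext => y; rewrite mxE fct_sumE. Qed.

Lemma differentiable_mulmx x : differentiable A x -> differentiable B x ->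
  differentiable (fun y => A y *m B y) x.
Proof.
move=> /differentiable_mxP dA /differentiable_mxP dB; apply/differentiable_mxP => i j.
rewrite mulmx_entry; apply: differentiable_sum => k.
exact: differentiableM.
Qed.

Lemma partial_mulmx i x : differentiable A x -> differentiable B x ->
  pd i (fun y => A y *m B y) x = pd i A x *m B x + A x *m pd i B x.
Proof.
move=> dA dB; have dAB := differentiable_mulmx dA dB.
have dA' := (differentiable_mxP A x).1 dA.
have dB' := (differentiable_mxP B x).1 dB.
apply/matrixP => k l; rewrite partial_mx // !mxE mulmx_entry partial_sum; last first.
  by move=> m; exact: differentiableM.
rewrite -big_split /=; apply: eq_bigr => m _.
by rewrite partialM // (partial_mx i k m dA) (partial_mx i m l dB).
Qed.

Lemma smooth_mulmx : smooth Om A -> smooth Om B -> smooth Om (fun y => A y *m B y).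
Proof.
move=> /smooth_mxP sA /smooth_mxP sB; apply/smooth_mxP => i j.
rewrite mulmx_entry; apply: (@eq_smooth _ (fun y => \sum_(k < q) (A y i k * B y k j))).
  by move=> x _; rewrite fct_sumE.
by apply: smooth_sum => k; exact: smoothM.
Qed.

End MatrixProduct.

Section Transpose.
Context {p q : nat} (A : 'cV[R]_n -> 'M[R]_(p, q)).

Lemma differentiable_trmx x : differentiable A x ->
  differentiable (fun y => (A y)^T) x.
Proof.
move=> dA; apply/differentiable_mxP => i j.
have -> : (fun y => (A y)^T i j : R) = (fun y => A y j i) by apply/funext => y; rewrite mxE.
exact: (differentiable_mxP A x).1.
Qed.

Lemma partial_trmx i x : differentiable A x ->
  pd i (fun y => (A y)^T) x = (pd i A x)^T.
Proof.
move=> dA; apply/matrixP => k l.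
rewrite partial_mx; last exact: differentiable_trmx.
have -> : (fun y => (A y)^T k l : R) = (fun y => A y l k) by apply/funext => y; rewrite mxE.
by rewrite [RHS]mxE partial_mx.
Qed.

Lemma smooth_trmx : smooth Om A -> smooth Om (fun y => (A y)^T).
Proof.
move=> /smooth_mxP sA; apply/smooth_mxP => i j.
by apply: eq_smooth (sA j i) => x _; rewrite mxE.
Qed.

Lemma differentiable_scalemx (s : 'cV[R]_n -> R) x :
  differentiable s x -> differentiable A x ->
  differentiable (fun y => s y *: A y) x.
Proof.
move=> ds dA; apply/differentiable_mxP => i j.
have -> : (fun y => (s y *: A y) i j : R) = s * (fun y => A y i j).
  by apply/funext => y; rewrite mxE.
by apply: differentiableM => //; exact: (differentiable_mxP A x).1.
Qed.

Lemma partial_scalemx (s : 'cV[R]_n -> R) i x :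
  differentiable s x -> differentiable A x ->
  pd i (fun y => s y *: A y) x = pd i s x *: A x + s x *: pd i A x.
Proof.
move=> ds dA; apply/matrixP => k l.
rewrite partial_mx; last exact: differentiable_scalemx.
have dA' := (differentiable_mxP A x).1 dA.
rewrite (_ : (fun y => _) = fun y => s y * A y k l); last first.
  by apply/funext => y; rewrite mxE.
by rewrite partialM // !mxE partial_mx.
Qed.

Lemma smooth_scalemx (s : 'cV[R]_n -> R) :
  smooth Om s -> smooth Om A -> smooth Om (fun y => s y *: A y).
Proof.
move=> ss /smooth_mxP sA; apply/smooth_mxP => i j.
by apply: eq_smooth (smoothM ss (sA i j)) => x _; rewrite mxE.
Qed.

End Transpose.

End Calculus.

(** * Symmetry of second derivatives, functions with zero derivative *)

Section Lines.
Context {R : realType} {n : nat}.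
Implicit Types (x p u w : 'cV[R]_n).

Lemma diff_partial {W : normedModType R} (f : 'cV[R]_n -> W) x w :
  differentiable f x -> 'd f x w = \sum_(i < n) w i 0 *: pd i f x.
Proof.
move=> df; rewrite {1}(matrix_sum_delta w) linear_sum; apply: eq_bigr => i _.
by rewrite big_ord1 linearZ partialE.
Qed.

Lemma is_derive_line {W : normedModType R} (f : 'cV[R]_n -> W) p u (t : R) :
  differentiable f (p + t *: u) ->
  is_derive t 1 (fun s : R => f (p + s *: u)) ('D_u f (p + t *: u)).
Proof.
move=> df.
pose l := fun s : R => p + s *: u.
have dl : is_diff t l ( *:%R^~ u).
  have := is_diffD (is_diff_cst p t) (is_diff_scalel t u).
  by rewrite add0r; exact.
have dfl : differentiable (f \o l) t.
  by apply: differentiable_comp => //; exact: ex_diff.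
apply: DeriveDef; first exact: diff_derivable.
rewrite (deriveE _ dfl) diff_comp //.
by rewrite /= [X in 'd f _ X](_ : _ = u) ?deriveE // diff_val scale1r.
Qed.

Lemma differentiable_translate {W : normedModType R} (f : 'cV[R]_n -> W) x c :
  differentiable f (x + c) -> differentiable (fun y => f (y + c)) x.
Proof.
move=> df; apply: (@differentiable_comp _ _ _ _ (fun y => y + c) f) => //.
Qed.

Lemma derive_translate {W : normedModType R} (f : 'cV[R]_n -> W) x c u :
  'D_u (fun y => f (y + c)) x = 'D_u f (x + c).
Proof.
rewrite /derive.
have E : (fun t : R => t^-1 *: (((fun y => f (y + c)) \o shift x) (t *: u) - f (x + c)))
    = (fun t => t^-1 *: ((f \o shift (x + c)) (t *: u) - f (x + c))).
  by apply/funext => t /=; rewrite addrA.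
by rewrite E.
Qed.

Lemma normr_delta i : `|delta_mx i 0 : 'cV[R]_n| <= 1.
Proof.
rewrite /Num.Def.normr/= mx_normrE; apply: bigmax_le => // ij _.
by rewrite mxE; case: (_ && _); rewrite /= ?normr1 ?normr0.
Qed.

(** The mean value theorem along the segment from p to p + s u. *)
Lemma MVT_line (f : 'cV[R]_n -> R) p u (s : R) : 0 < s ->
  (forall t, t \in `[0, s] -> differentiable f (p + t *: u)) ->
  exists2 t, t \in `]0, s[ & f (p + s *: u) - f p = s * 'D_u f (p + t *: u).
Proof.
move=> s0 df.
pose phi (t : R) := f (p + t *: u).
pose dphi t := 'D_u f (p + t *: u).
have H t : t \in `[0, s] -> is_derive t 1 phi (dphi t).
  by move=> ts; exact: is_derive_line (df t ts).
have Hoo t : t \in `]0, s[ -> is_derive t 1 phi (dphi t).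
  move=> ts; apply: H; move: ts; rewrite !in_itv /= => /andP[/ltW -> /ltW ->].
  by [].
have cphi : {within `[0, s], continuous phi}.
  apply: derivable_within_continuous => t ts.
  exact: (@ex_derive _ _ _ _ _ _ _ (H t ts)).
have [t ts E] := MVT s0 Hoo cphi.
exists t => //; move: E; rewrite /phi /dphi scale0r addr0 subr0 mulrC.
by [].
Qed.

End Lines.

Section Schwarz.
Context {R : realType} {n : nat} {Om : set 'cV[R]_n}.
Hypothesis Om_open : open Om.
Implicit Types (x : 'cV[R]_n).

Lemma ball_Om x : Om x -> exists2 e : R, 0 < e &
  forall y, `|y| < e -> Om (x + y).
Proof.
move=> Ox; have /nbhs_ballP [e /= e0 He] := near_Om Om_open Ox.
exists e => // y ye; apply: He; rewrite -ball_normE /= opprD addrA subrr sub0r.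
by rewrite normrN.
Qed.

(** Two functions continuous at x agree at x as soon as they take a common value
    at points arbitrarily close to x, possibly at different points. *)
Lemma close_values_eq (P Q : 'cV[R]_n -> R) x e : 0 < e ->
  {for x, continuous P} -> {for x, continuous Q} ->
  (forall r, 0 < r -> r <= e ->
    exists y z, [/\ `|y| < r, `|z| < r & P (x + y) = Q (x + z)]) ->
  P x = Q x.
Proof.
move=> e0 cP cQ PQ.
apply/eqP; rewrite -subr_eq0 -normr_eq0; apply/eqP.
apply: le_anti; rewrite normr_ge0 andbT.
apply/ler_addgt0Pr => d d0; rewrite add0r.
have d20 : 0 < d / 2 by rewrite divr_gt0.
have near_of (S : 'cV[R]_n -> R) : {for x, continuous S} ->
    exists2 r : R, 0 < r & forall y, `|y| < r -> `|S x - S (x + y)| < d / 2.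
  rewrite /prop_for /continuous_at.
  move/(@cvgrPdist_lt _ _ _ (nbhs x) (nbhs_filter x)) => /(_ _ d20) /nbhs_ballP[r /= r0 Hr].
  exists r => // y yr; apply: Hr; rewrite -ball_normE /= opprD addrA subrr sub0r.
  by rewrite normrN.
have [r1 r10 H1] := near_of P cP.
have [r2 r20 H2] := near_of Q cQ.
pose r := Num.min e (Num.min r1 r2).
have r0 : 0 < r by rewrite !lt_min e0 r10 r20.
have [re rr1 rr2] : [/\ r <= e, r <= r1 & r <= r2].
  by rewrite /r !ge_min !lexx !orbT.
have [y [z [yr zr E]]] := PQ r r0 re.
have /ltW A1 := H1 y (lt_le_trans yr rr1); have /ltW A2 := H2 z (lt_le_trans zr rr2).
rewrite (_ : P x - Q x = (P x - P (x + y)) - (Q x - Q (x + z))); last first.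
  by rewrite E; ring.
by rewrite [leRHS](splitr d); apply: le_trans (ler_normB _ _) (lerD _ _).
Qed.

Section Scalar.
Variable f : 'cV[R]_n -> R.

(** The second difference of f on the parallelogram at x spanned by s times the
    i-th and j-th unit vectors; it is symmetric in i and j. *)
Let second_difference (i j : 'I_n) x (s : R) :=
  f (x + s *: delta_mx i 0 + s *: delta_mx j 0) - f (x + s *: delta_mx i 0)
  - (f (x + s *: delta_mx j 0) - f x).

Lemma second_difference_sym i j x s :
  second_difference i j x s = second_difference j i x s.
Proof.
rewrite /second_difference [x + _ + _]addrAC.
ring.
Qed.

Hypothesis sf : smooth Om f.

(** Two applications of the mean value theorem write the second difference as
    s^2 times a mixed derivative at a nearby point. *)
Lemma second_differenceE i j x e s :
  (forall y, `|y| < e -> Om (x + y)) -> 0 < s -> s + s < e ->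
  exists2 y, `|y| < e & second_difference i j x s = s * (s * pd j (pd i f) (x + y)).
Proof.
move=> Hx s0 se.
set u : 'cV[R]_n := delta_mx i 0; set w : 'cV[R]_n := delta_mx j 0.
(* The norm is the supremum norm, for which co-ordinate vectors
   have norm at most 1. *)
have normE (a b : R) : a \in `[0, s] -> b \in `[0, s] -> `|a *: u + b *: w| < e.
  rewrite !in_itv /= => /andP[a0 sa] /andP[b0 sb].
  apply: le_lt_trans se; apply: le_trans (ler_normD _ _) _; apply: lerD.
    rewrite normrZ ger0_norm // -[leRHS]mulr1.
    by apply: ler_pM => //; exact: normr_delta.
  rewrite normrZ ger0_norm // -[leRHS]mulr1.
  by apply: ler_pM => //; exact: normr_delta.
have s_in : s \in `[0, s] by rewrite in_itv /= ltW /=.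
have z_in : 0 \in `[0, s] by rewrite in_itv /= lexx ltW.
have OE a b : a \in `[0, s] -> b \in `[0, s] -> Om (x + a *: u + b *: w).
  by move=> ia ib; rewrite -addrA; apply/Hx/normE.
have O1 a : a \in `[0, s] -> Om (x + a *: u).
  by move=> ia; rewrite -[x + _]addr0 -(scale0r w); exact: OE.
have df z : Om z -> differentiable f z by exact: smooth_differentiable.
pose g z := f (z + s *: w) - f z.
have dsh z : Om (z + s *: w) -> differentiable (fun y => f (y + s *: w)) z.
  by move=> Oz; apply: differentiable_translate; exact: df.
have dsum a : a \in `[0, s] -> differentiable g (x + a *: u).
  by move=> ia; apply: differentiableB; [apply/dsh/OE | apply/df/O1].
have [a ia E1] := MVT_line s0 dsum.
have {}ia : a \in `[0, s] by exact: subset_itv_oo_cc.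
have Dg : 'D_u g (x + a *: u) =
    pd i f (x + a *: u + s *: w) - pd i f (x + a *: u).
  rewrite /g deriveB; [|exact/diff_derivable/dsh/OE|exact/diff_derivable/df/O1].
  by rewrite derive_translate pd.unlock.
have dpf b : b \in `[0, s] -> differentiable (pd i f) (x + a *: u + b *: w).
  move=> ib; apply: (smooth_differentiable (Om := Om)); last exact: OE.
  exact: smooth_partial.
have [b ib E2] := MVT_line s0 dpf.
have {}ib : b \in `[0, s] by exact: subset_itv_oo_cc.
exists (a *: u + b *: w); first exact: normE.
rewrite /second_difference -/(g x) -/(g (x + s *: u)) E1 Dg E2.
by rewrite pd.unlock /partial addrA.
Qed.

(** The theorem of Schwarz. *)
Lemma partialC_scalar i j x : Om x ->
  pd i (pd j f) x = pd j (pd i f) x.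
Proof.
move=> Ox; have [e e0 He] := ball_Om Ox.
have cont k l : {for x, continuous (pd k (pd l f))}.
  have : Ck Om 0 (pd k (pd l f)) by apply: smooth_partial; exact: smooth_partial.
  exact.
apply: (close_values_eq e0 (cont i j) (cont j i)) => r r0 re.
have Hr y : `|y| < r -> Om (x + y) by move=> yr; apply/He/(lt_le_trans yr).
(* The points of the parallelogram of side r / 3 at x are within 2 r / 3 of x. *)
have s0 : 0 < r / 3 by rewrite divr_gt0.
have se : r / 3 + r / 3 < r by lra.
have [y yr Ey] := second_differenceE j i Hr s0 se.
have [z zr Ez] := second_differenceE i j Hr s0 se.
have E := etrans (etrans (esym Ey) (second_difference_sym j i x (r / 3))) Ez.
exists y, z; split; [exact: yr | exact: zr |].
exact: (mulfI (lt0r_neq0 s0) (mulfI (lt0r_neq0 s0) E)).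
Qed.

End Scalar.

Lemma partialC {p q : nat} (A : 'cV[R]_n -> 'M[R]_(p, q)) i j x :
  smooth Om A -> Om x -> pd i (pd j A) x = pd j (pd i A) x.
Proof.
move=> sA Ox; apply/matrixP => k l.
have dA k' z : Om z -> differentiable (pd k' A) z.
  by move=> Oz; apply: smooth_differentiable Oz; exact: smooth_partial.
have dA0 z : Om z -> differentiable A z by exact: smooth_differentiable.
rewrite (partial_mx i k l (dA j x Ox)) (partial_mx j k l (dA i x Ox)).
have E k' : forall z, Om z ->
    pd k' A z k l = pd k' (fun y => A y k l : R) z.
  by move=> z Oz; rewrite partial_mx //; exact: dA0.
rewrite (eq_partial Om_open i (E j) Ox) (eq_partial Om_open j (E i) Ox).
by apply: partialC_scalar Ox; exact: (smooth_mxP Om_open A).1.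
Qed.

(** A map with vanishing derivatives on a connected open set is constant there. *)
Lemma constant_on_connected {p q : nat} (A : 'cV[R]_n -> 'M[R]_(p, q)) :
  connected Om -> (forall x, Om x -> differentiable A x) ->
  (forall x i, Om x -> pd i A x = 0) ->
  forall x y, Om x -> Om y -> A x = A y.
Proof.
move=> cOm dA pA.
have local x : Om x -> \forall y \near x, Om y /\ A y = A x.
  move=> Ox; have [e e0 He] := ball_Om Ox.
  apply/nbhs_ballP; exists e => //= z; rewrite -ball_normE /= => xz.
  have zE : z = x + (z - x) by rewrite addrC subrK.
  have wE : `|z - x| < e by rewrite distrC.
  split; first by rewrite zE; exact: He.
  have O1 t : t \in `[0, 1] -> Om (x + t *: (z - x)).
    rewrite in_itv /= => /andP[t0 t1]; apply: He; rewrite normrZ ger0_norm //.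
    by apply: le_lt_trans wE; rewrite ler_piMl.
  apply/matrixP => k l; apply/eqP; rewrite -subr_eq0; apply/eqP.
  have dAkl t : t \in `[0, 1] -> differentiable (fun y => A y k l : R) (x + t *: (z - x)).
    by move=> it; apply: (differentiable_mxP A _).1; exact/dA/O1.
  have [t it] := MVT_line ltr01 dAkl.
  rewrite scale1r -zE => ->; rewrite mul1r.
  have {}it : t \in `[0, 1] by exact: subset_itv_oo_cc.
  rewrite deriveE; last exact: dAkl.
  rewrite diff_partial; last exact: dAkl.
  apply: big1 => i _; rewrite -partial_mx; last exact/dA/O1.
  by rewrite pA ?mxE ?scaler0 //; exact: O1.
(* A is locally constant, so every set defined by the value of A is open; the
   level set of A x and its complement are both of this form. *)
have opn (P : 'M[R]_(p, q) -> Prop) : open [set x | Om x /\ P (A x)].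
  rewrite openE => x [Ox Px]; apply: filterS (local x Ox) => z [Oz Az].
  by split => //; rewrite Az.
move=> x y Ox Oy.
suff E : [set z | Om z /\ A z = A x] = Om by move: Oy; rewrite -{1}E => -[].
apply: cOm; first by exists x.
  exists [set z | Om z /\ A z = A x]; first exact: opn (fun a => a = A x).
  by apply/seteqP; split => z [] // ? [].
exists (~` [set z | Om z /\ A z <> A x]).
  by rewrite closedC; exact: (opn (fun a => a <> A x)).
apply/seteqP; split => z /=; first by move=> [Oz Az]; split => // -[].
move=> [Oz nAz]; split => //; apply: contrapT => Az; exact: nAz.
Qed.

End Schwarz.

(** * The Lorentzian form *)

Section Minkowski.
Context {R : realType}.

(** The j-th diagonal entry of the matrix diag(1, ..., 1, -1) of size k. *)
Definition msign (k : nat) (j : 'I_k) : R := if j.+1 == k then -1 else 1.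

Lemma msign_sqr k (j : 'I_k) : msign j * msign j = 1.
Proof. by rewrite /msign; case: ifP => _; rewrite ?mulrNN mulr1. Qed.

Lemma Imink_entry k (i j : 'I_k) : Imink R k i j = msign i *+ (i == j).
Proof.
by rewrite /Imink !mxE; case: (eqVneq i j) => [->|].
Qed.

Lemma tr_Im k : (Imink R k)^T = Imink R k.
Proof. exact: tr_diag_mx. Qed.

Lemma ImK k : Imink R k *m Imink R k = 1%:M.
Proof.
apply/matrixP => i j; rewrite mul_diag_mx !mxE.
by case: (eqVneq i j) => [->|_] /=; rewrite ?mulr0 // !mulr1n -/(msign j) msign_sqr.
Qed.

Lemma mul_ImK k l (A : 'M[R]_(k, l)) : Imink R k *m (Imink R k *m A) = A.
Proof. by rewrite mulmxA ImK mul1mx. Qed.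

Lemma mulIm_entry k l (A : 'M[R]_(k, l)) i j : (Imink R k *m A) i j = msign i * A i j.
Proof. by rewrite mul_diag_mx !mxE. Qed.

Lemma mul_Imink_entry k l (A : 'M[R]_(l, k)) i j :
  (A *m Imink R k) i j = A i j * msign j.
Proof. by rewrite mul_mx_diag !mxE. Qed.

Lemma Im_double n : (0 < n)%N -> Imink R (n + n) = block_mx 1%:M 0 0 (Imink R n).
Proof.
move=> n0; apply/matrixP => i j; rewrite Imink_entry.
case: (split_ordP i) => i' ->; case: (split_ordP j) => j' ->.
- rewrite block_mxEul mxE (inj_eq (@lshift_inj _ _)) /msign /= ifF //.
  apply/eqP => E; have := ltn_ord i'.
  by rewrite E -[leqRHS]addn0 leq_add2l leqNgt n0.
- by rewrite block_mxEur mxE eq_lrshift.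
- by rewrite block_mxEdl mxE eq_rlshift.
- rewrite block_mxEdr (inj_eq (@rshift_inj _ _)) Imink_entry /msign /=.
  by rewrite -addnS eqn_add2l.
Qed.

Section Form.
Context {k : nat}.
Implicit Types (x y z : 'cV[R]_k).

Lemma minkE x y : mink x y = \sum_a msign a * (x a 0 * y a 0).
Proof.
rewrite /mink -mulmxA mxE; apply: eq_bigr => a _.
by rewrite mulIm_entry mxE mulrCA.
Qed.

Lemma minkC x y : mink x y = mink y x.
Proof. by rewrite !minkE; apply: eq_bigr => a _; rewrite [x a 0 * _]mulrC. Qed.

Lemma minkDl x y z : mink (x + y) z = mink x z + mink y z.
Proof. by rewrite /mink linearD /= !mulmxDl mxE. Qed.

Lemma minkNl x z : mink (- x) z = - mink x z.
Proof. by rewrite /mink linearN /= !mulNmx mxE. Qed.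

Lemma minkBl x y z : mink (x - y) z = mink x z - mink y z.
Proof. by rewrite minkDl minkNl. Qed.

Lemma minkZl (a : R) x z : mink (a *: x) z = a * mink x z.
Proof. by rewrite /mink linearZ /= -!scalemxAl mxE. Qed.

Lemma mink0l z : mink 0 z = 0.
Proof. by rewrite -[0](scale0r 0) minkZl mul0r. Qed.

Lemma mink_suml (I : finType) (f : I -> 'cV[R]_k) z :
  mink (\sum_i f i) z = \sum_i mink (f i) z.
Proof.
exact: (big_morph (fun x => mink x z) (fun x y => minkDl x y z) (mink0l z)).
Qed.

Lemma minkDr x y z : mink z (x + y) = mink z x + mink z y.
Proof. by rewrite ![mink z _]minkC minkDl. Qed.

Lemma minkNr x z : mink z (- x) = - mink z x.
Proof. by rewrite ![mink z _]minkC minkNl. Qed.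

Lemma minkBr x y z : mink z (x - y) = mink z x - mink z y.
Proof. by rewrite minkDr minkNr. Qed.

Lemma minkZr (a : R) x z : mink z (a *: x) = a * mink z x.
Proof. by rewrite ![mink z _]minkC minkZl. Qed.

Lemma mink_sumr (I : finType) (f : I -> 'cV[R]_k) z :
  mink z (\sum_i f i) = \sum_i mink z (f i).
Proof. by rewrite minkC mink_suml; apply: eq_bigr => i _; rewrite minkC. Qed.

Lemma mink_nondegenerate x : (forall y, mink x y = 0) -> x = 0.
Proof.
move=> H; apply/matrixP => i j; rewrite ord1 mxE.
have := H (delta_mx i 0); rewrite minkE (bigD1 i) //= big1.
  rewrite mxE !eqxx mulr1 addr0 => /eqP; rewrite mulf_eq0 => /orP[/eqP E|/eqP //].
  by have := msign_sqr i; rewrite E mul0r => /esym/eqP; rewrite oner_eq0.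
by move=> a ai; rewrite mxE (negbTE ai) !mulr0.
Qed.

(** The Gram matrix of the columns of A against those of B. *)
Lemma gram_entry p q (A : 'M[R]_(k, p)) (B : 'M[R]_(k, q)) i j :
  (A^T *m Imink R k *m B) i j = mink (col i A) (col j B).
Proof.
rewrite minkE -mulmxA mxE; apply: eq_bigr => a _.
by rewrite mulIm_entry !mxE mulrCA.
Qed.

End Form.

(** Two time-like vectors x and y of a Lorentzian space are not orthogonal: the
    combination of them whose last co-ordinate vanishes would be time-like,
    whereas the form is positive on that hyperplane. *)
Lemma timelike_not_orthogonal k (x y : 'cV[R]_k) :
  mink x x < 0 -> mink y y < 0 -> mink x y != 0.
Proof.
case: k x y => [|k] x y; first by rewrite minkE big_ord0 ltxx.
have pos (z : 'cV[R]_k.+1) : z ord_max 0 = 0 -> 0 <= mink z z.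
  move=> z0; rewrite minkE; apply: sumr_ge0 => a _.
  rewrite /msign; case: eqP => [[ak]|_]; last by rewrite mul1r -expr2 sqr_ge0.
  by rewrite (_ : a = ord_max) ?z0 ?mulr0 //; exact/val_inj.
move=> xx yy; apply/eqP => xy.
have x0 : x ord_max 0 != 0.
  by apply: contraTneq xx => /pos; rewrite -leNgt.
pose z := y ord_max 0 *: x - x ord_max 0 *: y.
have := pos z; rewrite !mxE mulrC subrr => /(_ erefl).
rewrite /z !minkBl !minkBr !minkZl !minkZr [mink y x]minkC xy !mulr0 subr0 sub0r opprK.
rewrite leNgt => /negP; apply.
have : 0 < x ord_max 0 ^+ 2 by rewrite exprn_even_gt0.
have := sqr_ge0 (y ord_max 0).
nra.
Qed.

End Minkowski.

Section MinkowskiCalculus.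
Context {R : realType} {n k : nat} {Om : set 'cV[R]_n}.
Hypothesis Om_open : open Om.
Variables (f g : 'cV[R]_n -> 'cV[R]_k).

Lemma partial_mink i x : differentiable f x -> differentiable g x ->
  pd i (fun y => mink (f y) (g y)) x =
  mink (pd i f x) (g x) + mink (f x) (pd i g x).
Proof.
move=> df dg; have dft := differentiable_trmx df.
have dI : differentiable (cst (Imink R k) : 'cV[R]_n -> _) x by [].
have dfI := differentiable_mulmx dft dI.
rewrite /mink -partial_mx; last exact: differentiable_mulmx.
rewrite partial_mulmx // mxE; congr (_ + _).
rewrite (partial_mulmx i dft dI) partial_trmx // [pd i (cst _) x]partial_cst.
by rewrite mulmx0 addr0.
Qed.

Lemma smooth_mink : smooth Om f -> smooth Om g ->
  smooth Om (fun y => mink (f y) (g y)).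
Proof.
move=> sf sg.
have : smooth Om (fun y => (f y)^T *m Imink R k *m g y).
  apply: (smooth_mulmx Om_open) sg.
  apply: (smooth_mulmx Om_open (B := cst (Imink R k))); first exact: smooth_trmx.
  exact: smooth_cst.
by move=> /(smooth_mxP Om_open) /(_ 0 0).
Qed.

End MinkowskiCalculus.

(** * The Killing form on block matrices *)

Section Trace.
Context {R : realType} {W : vectType R} (V : {vspace W}).
Implicit Types (f g : W -> W).

Lemma eq_trace_on f g : (forall x, x \in V -> f x = g x) ->
  trace_on V f = trace_on V g.
Proof.
move=> fg; apply: eq_bigr => i _; rewrite fg //.
by apply: vbasis_mem; apply: mem_nth; rewrite size_tuple.
Qed.

(** Cyclicity of the trace on V, for two linear maps that preserve V. *)
Lemma trace_onC (f g : {linear W -> W}) :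
  (forall x, x \in V -> f x \in V) -> (forall x, x \in V -> g x \in V) ->
  trace_on V (fun x => f (g x)) = trace_on V (fun x => g (f x)).
Proof.
move=> fV gV.
have bV (i : 'I_(\dim V)) : (vbasis V)`_i \in V.
  by apply: vbasis_mem; apply: mem_nth; rewrite size_tuple.
have expand (f' g' : {linear W -> W}) : (forall x, x \in V -> g' x \in V) ->
    trace_on V (fun x => f' (g' x)) =
    \sum_(i < \dim V) \sum_(j < \dim V)
      coord (vbasis V) j (g' (vbasis V)`_i) * coord (vbasis V) i (f' (vbasis V)`_j).
  move=> gV'; apply: eq_bigr => i _.
  rewrite {1}(coord_vbasis (gV' _ (bV i))) linear_sum linear_sum.
  by apply: eq_bigr => j _; rewrite !linearZ.
rewrite (expand f g) // (expand g f) // exchange_big /=.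
by apply: eq_bigr => i _; apply: eq_bigr => j _; rewrite mulrC.
Qed.

End Trace.

Section Killing.
Context {R : realType} {k : nat}.
Local Notation V := (lorentz_algebra R k).
Implicit Types (X Y Z S : 'M[R]_k).

Lemma lorentz_algebraE X : (X \in V) = (X^T *m Imink R k == - (Imink R k *m X)).
Proof. by rewrite lorentz_algebraP addr_eq0. Qed.

Lemma lie_lorentz X Y : X \in V -> Y \in V -> lie X Y \in V.
Proof.
rewrite !lorentz_algebraE => /eqP XV /eqP YV; apply/eqP.
rewrite /lie linearB /= !trmx_mul mulmxBl -!mulmxA XV YV !mulmxN !mulmxA XV YV.
by rewrite mulmxBr !mulNmx !opprK opprB !mulmxA.
Qed.

Lemma lie_linear X : linear (lie X).
Proof.
move=> c A B; rewrite /lie mulmxDr mulmxDl -scalemxAr -scalemxAl scalerBr.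
by rewrite opprD addrACA.
Qed.

Lemma lieDl X Y Z : lie (X + Y) Z = lie X Z + lie Y Z.
Proof. by rewrite /lie mulmxDl mulmxDr opprD addrACA. Qed.

Lemma lieNl X Z : lie (- X) Z = - lie X Z.
Proof. by rewrite /lie mulNmx mulmxN opprB addrC opprK. Qed.

Lemma killingDl X X' Y : killing (X + X') Y = killing X Y + killing X' Y.
Proof.
rewrite /killing /trace_on -big_split /=; apply: eq_bigr => i _.
by rewrite lieDl linearD.
Qed.

Lemma killingNl X Y : killing (- X) Y = - killing X Y.
Proof.
rewrite /killing /trace_on -sumrN /=; apply: eq_bigr => i _.
by rewrite lieNl linearN.
Qed.

Lemma killing0l Y : killing 0 Y = 0.
Proof. by rewrite -[X in killing X](subrr 0) killingDl killingNl subrr. Qed.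

Lemma killing_suml (I : finType) (f : I -> 'M[R]_k) Y :
  killing (\sum_i f i) Y = \sum_i killing (f i) Y.
Proof.
exact: (big_morph (fun X => killing X Y) (fun X X' => killingDl X X' Y) (killing0l Y)).
Qed.

(** Conjugation by an involution of the Lorentz group preserves the Killing form. *)
Lemma killing_conj S X Y : S *m S = 1%:M -> S^T *m Imink R k *m S = Imink R k ->
  X \in V -> Y \in V ->
  killing (S *m X *m S) (S *m Y *m S) = killing X Y.
Proof.
move=> SS SL XV YV.
pose sg Z := S *m Z *m S.
have sgK : involutive sg by move=> Z; rewrite /sg !mulmxA SS mul1mx -mulmxA SS mulmx1.
have sgM A B : sg A *m sg B = sg (A *m B).
  by rewrite /sg !mulmxA -[_ *m S *m S]mulmxA SS mulmx1.
have sg_lie A B : lie (sg A) (sg B) = sg (lie A B).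
  by rewrite /lie !sgM /sg mulmxBr mulmxBl.
have sg_lin : linear sg.
  by move=> c A B; rewrite /sg mulmxDr mulmxDl -scalemxAr -scalemxAl.
have SI : S^T *m Imink R k = Imink R k *m S by rewrite -{2}SL -!mulmxA SS mulmx1.
have sgV Z : Z \in V -> sg Z \in V.
  rewrite !lorentz_algebraE => /eqP ZV; apply/eqP.
  have E : Z^T *m (Imink R k *m S) = - (Imink R k *m Z *m S).
    by rewrite mulmxA ZV mulNmx.
  by rewrite /sg !trmx_mul -!mulmxA SI E mulmxN !mulmxA SI.
pose sgL : {linear 'M[R]_k -> 'M[R]_k} :=
  HB.pack sg (GRing.isLinear.Build _ _ _ _ _ sg_lin).
pose adsg Z := lie X (lie Y (sg Z)).
have adsg_lin : linear adsg.
  by move=> c A B; rewrite /adsg sg_lin !lie_linear.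
pose adsgL : {linear 'M[R]_k -> 'M[R]_k} :=
  HB.pack adsg (GRing.isLinear.Build _ _ _ _ _ adsg_lin).
transitivity (trace_on V (fun Z => sgL (adsgL Z))).
  apply: eq_trace_on => Z _; rewrite /= /adsg -!sg_lie sgK //.
rewrite (trace_onC (f := sgL) (g := adsgL)) //; last first.
  by move=> Z ZV /=; rewrite /adsg; do 2?apply: lie_lorentz => //; exact: sgV.
by apply: eq_trace_on => Z _; rewrite /= /adsg sgK.
Qed.

End Killing.

Section KillingBlocks.
Context {R : realType} {n : nat}.
Hypothesis n_gt0 : (0 < n)%N.
Local Notation V := (lorentz_algebra R (n + n)).

(** The diagonal matrix that changes the sign of the k-th co-ordinate. *)
Let flip (k : 'I_n) : 'M[R]_n := diag_mx (\row_i (if i == k then -1 else 1)).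

Let flipE k (A : 'M[R]_n) i j : (flip k *m A *m flip k) i j =
  (if i == k then -1 else 1) * (if j == k then -1 else 1) * A i j.
Proof. by rewrite mul_mx_diag mul_diag_mx !mxE mulrAC. Qed.

Let flip_sqr k : flip k *m flip k = 1%:M.
Proof.
apply/matrixP => i j; rewrite mul_diag_mx !mxE.
case: (eqVneq i j) => [->|_] /=; rewrite ?mulr0 // !mulr1n.
by case: ifP => _; rewrite ?mulrNN mulr1.
Qed.

(* Off the diagonal, conjugation by [flip k] changes the sign of the entry (i, j)
   exactly for k = i and k = j, whence 2 + 2 = 4. *)
Let sum_flip (B : 'M[R]_n) : (forall i, B i i = 0) ->
  \sum_k (B - flip k *m B *m flip k) = B *+ 4.
Proof.
move=> B0; apply/matrixP => i j; rewrite summxE mulmxnE.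
under eq_bigr do rewrite mxE [X in _ + X]mxE flipE.
case: (eqVneq i j) => [<-|ij].
  by rewrite B0 mul0rn big1 // => k _; rewrite mulr0 subrr.
rewrite (bigD1 i) //= (bigD1 j) ?(eq_sym j) //= big1 => [|k /andP[ki kj]].
  by rewrite !eqxx (negbTE ij); ring.
by rewrite ![_ == k]eq_sym (negbTE ki) (negbTE kj) !mul1r subrr.
Qed.

(** Matrices in p whose blocks have zero diagonal are orthogonal, for the Killing
    form, to those whose blocks are diagonal. *)
Lemma killing_off_diagonal (B C B' C' : 'M[R]_n) :
  block_mx 0 B C 0 \in V -> block_mx 0 B' C' 0 \in V ->
  (forall i, B i i = 0) -> (forall i, C i i = 0) ->
  (forall i j, i != j -> B' i j = 0) -> (forall i j, i != j -> C' i j = 0) ->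
  killing (block_mx 0 B C 0) (block_mx 0 B' C' 0) = 0.
Proof.
set X := block_mx 0 B C 0; set Y := block_mx 0 B' C' 0.
move=> XV YV B0 C0 B'd C'd.
pose S k : 'M[R]_(n + n) := block_mx (flip k) 0 0 (flip k).
(* S k acts on each block by conjugation with [flip k]. *)
have SE k A D : S k *m block_mx 0 A D 0 *m S k =
    block_mx 0 (flip k *m A *m flip k) (flip k *m D *m flip k) 0.
  by rewrite !mulmx_block !(mul0mx, mulmx0, add0r, addr0).
have SS k : S k *m S k = 1%:M.
  rewrite mulmx_block !(mul0mx, mulmx0, add0r, addr0) !flip_sqr.
  by rewrite -scalar_mx_block.
have SI k : (S k)^T *m Imink R (n + n) *m S k = Imink R (n + n).
  rewrite Im_double // tr_block_mx !trmx0 !tr_diag_mx !mulmx_block.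
  rewrite !(mul0mx, mulmx0, add0r, addr0, mulmx1) flip_sqr.
  by rewrite diag_mxC -mulmxA flip_sqr mulmx1.
have flip_diag k (A : 'M[R]_n) : (forall i j, i != j -> A i j = 0) ->
    flip k *m A *m flip k = A.
  move=> A0; apply/matrixP => i j; rewrite flipE.
  case: (eqVneq i j) => [->|/A0 ->]; last by rewrite mulr0.
  by case: ifP => _; rewrite ?mulrNN ?mulr1 mul1r.
have SY k : S k *m Y *m S k = Y by rewrite SE !flip_diag.
have E k : killing (X - S k *m X *m S k) Y = 0.
  rewrite killingDl killingNl -{2}(SY k) killing_conj ?subrr //.
have sumE : \sum_k (X - S k *m X *m S k) = X *+ 4.
  have step k : X - S k *m X *m S k =
      block_mx 0 (B - flip k *m B *m flip k) (C - flip k *m C *m flip k) 0.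
    by rewrite SE opp_block_mx add_block_mx !oppr0 !addr0.
  apply/matrixP => i j; rewrite summxE mulmxnE.
  under eq_bigr do rewrite step.
  case: (split_ordP i) => i' ->; case: (split_ordP j) => j' ->.
  - under eq_bigr do rewrite block_mxEul mxE.
    by rewrite big1 // block_mxEul mxE mul0rn.
  - under eq_bigr do rewrite block_mxEur.
    by rewrite block_mxEur -summxE sum_flip // mulmxnE.
  - under eq_bigr do rewrite block_mxEdl.
    by rewrite block_mxEdl -summxE sum_flip // mulmxnE.
  - under eq_bigr do rewrite block_mxEdr mxE.
    by rewrite big1 // block_mxEdr mxE mul0rn.
have : killing (X *+ 4) Y = 0 by rewrite -sumE killing_suml big1.
rewrite !mulrS mulr0n addr0 !killingDl => K4.
by move: K4; lra.
Qed.

End KillingBlocks.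

(** * Algebra of the Cartan decomposition *)

Section Blocks.
Context {R : realType} {n : nat}.
Hypothesis n_gt0 : (0 < n)%N.
Local Notation J := (Imink R n).
Implicit Types (i j k : 'I_n).

Lemma mink_lorentz {m : nat} (A : 'M[R]_m) (y z : 'cV[R]_m) :
  lorentz_group A -> mink (A *m y) (A *m z) = mink y z.
Proof.
move=> AL; rewrite /mink trmx_mul.
by rewrite -[in RHS](AL : _ = _) !mulmxA.
Qed.

Lemma lorentz_right_inverse {m : nat} (A : 'M[R]_m) : lorentz_group A ->
  A *m (Imink R m *m (A^T *m Imink R m)) = 1%:M.
Proof. by move=> AL; apply: mulmx1C; rewrite -!mulmxA [A^T *m _]mulmxA (AL : _ = _) ImK. Qed.

Lemma lorentz_unitmx {m : nat} (A : 'M[R]_m) : lorentz_group A -> A \in unitmx.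
Proof. by move=> /lorentz_right_inverse /mulmx1_unit []. Qed.

Lemma mink_col_mx0 (f g : 'cV[R]_n) :
  mink (col_mx (0 : 'cV[R]_n) f) (col_mx (0 : 'cV[R]_n) g) = mink f g.
Proof.
rewrite /mink Im_double // tr_col_mx trmx0 mul_row_block mul_row_col.
by rewrite !(mul0mx, mulmx0, add0r, addr0).
Qed.

Lemma p_space_lorentz (X : 'M[R]_(n + n)) : p_space X -> X \in lorentz_algebra R (n + n).
Proof.
move=> [eta ->]; rewrite lorentz_algebraE Im_double // tr_block_mx !mulmx_block.
rewrite !(mul0mx, mulmx0, add0r, addr0, mul1mx, mulmx1) trmx0 opp_block_mx !oppr0.
rewrite !trmx_mul trmxK tr_Im linearN /= mulNmx mulmxN opprK.
by rewrite !(mul0mx, mulmx0, add0r, addr0).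
Qed.

Lemma a_space_p_space (X : 'M[R]_(n + n)) : a_space X -> p_space X.
Proof. by move=> [d ->]; exists (diag_mx d); rewrite tr_diag_mx. Qed.

Lemma Xi_p_space (h : 'I_n -> 'cV[R]_n -> R) x : p_space (Xi h x).
Proof.
by exists (J *m xi h x); rewrite trmx_mul tr_Im -mulmxA ImK mulmx1.
Qed.

Lemma Xi_a_perp (h : 'I_n -> 'cV[R]_n -> R) x : a_perp (Xi h x).
Proof.
have xi0 i : xi h x i i = 0 by rewrite mxE eqxx.
split=> [|Y aY]; first exact/p_space_lorentz/Xi_p_space.
have := p_space_lorentz (a_space_p_space aY); case: aY => d -> YV.
apply: killing_off_diagonal => //.
- exact/p_space_lorentz/Xi_p_space.
- by move=> i; rewrite mxE.
- by move=> i; rewrite mxE mulIm_entry xi0 mulr0 oppr0.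
- by move=> i j ij; rewrite mul_diag_mx !mxE (negbTE ij) mulr0.
- by move=> i j ij; rewrite !mxE (negbTE ij) oppr0.
Qed.

Lemma delta_ImE i : delta_mx i i *m J = msign i *: delta_mx i i :> 'M[R]_n.
Proof.
apply/matrixP => a b; rewrite mul_mx_diag !mxE.
by case: (eqVneq b i) => [->|_]; rewrite ?andbF /= ?mulr0 ?mul0r // andbT mulrC.
Qed.

Lemma a_basis_mul0 i j : i != j -> a_basis R i *m a_basis R j = 0.
Proof.
move=> ij; rewrite /a_basis mulmx_block !(mul0mx, mulmx0, add0r, addr0) !delta_ImE.
rewrite mulNmx mulmxN -scalemxAl -scalemxAr !mul_delta_mx_cond.
by rewrite (negbTE ij) !mulr0n !scaler0 !oppr0 -block_mx0.
Qed.

(** The coefficient a_i + [a_i, X] of dx_i in the connection form of the frame. *)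
Definition connection i (X : 'M[R]_(n + n)) := a_basis R i + lie (a_basis R i) X.

Lemma lie_a_basis_Xi i (h : 'I_n -> 'cV[R]_n -> R) x :
  lie (a_basis R i) (Xi h x) =
  block_mx (delta_mx i i *m xi h x - (xi h x)^T *m delta_mx i i) 0
           0 (delta_mx i i *m (xi h x)^T - J *m xi h x *m delta_mx i i *m J).
Proof.
rewrite /lie /a_basis /Xi !mulmx_block !(mul0mx, mulmx0, add0r, addr0).
rewrite opp_block_mx add_block_mx !oppr0 !addr0.
by rewrite !mulNmx !mulmxN !opprK -!mulmxA mul_ImK.
Qed.

(** By the Jacobi identity, and as the a_i commute, all terms of the bracket that
    involve some a_i outside of [a_i, X] cancel. *)
Lemma connection_bracket i j (X : 'M[R]_(n + n)) : i != j ->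
  lie (connection i X) (connection j X) =
  lie (lie (a_basis R i) X) (lie (a_basis R j) X).
Proof.
move=> ij; have ab := a_basis_mul0 ij.
have ba : a_basis R j *m a_basis R i = 0 by rewrite a_basis_mul0 // eq_sym.
rewrite /connection; set a := a_basis R i in ab ba *; set b := a_basis R j in ab ba *.
have gen (A B : 'M[R]_(n + n)) : a *m B + A *m b = b *m A + B *m a ->
    lie (a + A) (b + B) = lie A B.
  move=> E; rewrite /lie !mulmxDl !mulmxDr ab ba !add0r.
  move: E; move: (a *m B) (A *m b) (b *m A) (B *m a) (A *m B) (B *m A).
  move=> p q r s t w E; have -> : q = r + s - p by rewrite -E addrC addKr.
  by apply/matrixP => k l; rewrite !mxE; ring.
apply: gen; rewrite /lie !mulmxBr !mulmxBl !mulmxA ab ba !mul0mx -!mulmxA ab ba !mulmx0.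
by rewrite !sub0r !subr0 !addNr.
Qed.

End Blocks.

(** * Immersions in line of curvature co-ordinates *)

Section Columns.
Context {R : realType} {n p q : nat} {Om : set 'cV[R]_n}.
Hypothesis Om_open : open Om.

Lemma partial_col (A : 'cV[R]_n -> 'M[R]_(p, q)) (j : 'I_q) i x :
  differentiable A x -> col j (pd i A x) = pd i (fun z => col j (A z)) x.
Proof.
move=> dA.
have dc : differentiable (fun z => col j (A z)) x.
  apply/differentiable_mxP => a b.
  have -> : (fun z => col j (A z) a b : R) = (fun z => A z a j).
    by apply/funext => z; rewrite mxE.
  exact: (differentiable_mxP A x).1.
apply/matrixP => a b; rewrite mxE (partial_mx i a j dA) (partial_mx i a b dc).
by congr (pd i _ x); apply/funext => z; rewrite mxE.
Qed.

Lemma smooth_col (A : 'cV[R]_n -> 'M[R]_(p, q)) :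
  (forall j, smooth Om (fun z => col j (A z))) -> smooth Om A.
Proof.
move=> sA; apply/(smooth_mxP Om_open) => a b.
apply: eq_smooth ((smooth_mxP Om_open _).1 (sA b) a 0) => // x _.
by rewrite mxE.
Qed.

End Columns.

Section Immersion.
Context {R : realType} {n : nat} {Om : set 'cV[R]_n}.
Context {F : 'cV[R]_n -> 'cV[R]_(n + n)}.
Context {v : 'I_n -> 'cV[R]_n -> 'cV[R]_(n + n)} {h : 'I_n -> 'cV[R]_n -> R}.
Hypothesis n_gt0 : (0 < n)%N.
Hypothesis Om_open : open Om.
Hypothesis F_smooth : smooth Om F.
Hypothesis h_gt0 : forall x, Om x -> forall i, 0 < h i x.
Hypothesis metric_h :
  forall x, Om x -> metric F x = diag_mx (\row_i (h i x ^+ 2)).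
Implicit Types (i j k l : 'I_n) (x : 'cV[R]_n) (y : 'cV[R]_(n + n)).

Lemma smooth_dF i : smooth Om (pd i F).
Proof. exact: smooth_partial. Qed.

Lemma smooth_ddF i j : smooth Om (pd i (pd j F)).
Proof. by do 2!apply: smooth_partial. Qed.

Lemma ddFC i j x : Om x -> pd i (pd j F) x = pd j (pd i F) x.
Proof. exact: partialC. Qed.

Lemma h_neq0 i x : Om x -> h i x != 0.
Proof. by move=> Ox; exact/lt0r_neq0/h_gt0. Qed.

Lemma col_jac i x : col i (jac F x) = pd i F x.
Proof. by apply/matrixP => a b; rewrite !mxE ord1 pdE. Qed.

Lemma metricE i j x : metric F x i j = mink (pd i F x) (pd j F x).
Proof. by rewrite /metric gram_entry !col_jac. Qed.

Lemma mink_dF i j x : Om x ->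
  mink (pd i F x) (pd j F x) = (h i x ^+ 2) *+ (i == j).
Proof. by move=> Ox; rewrite -metricE metric_h // !mxE; case: eqVneq => [->|]. Qed.

Lemma invmx_metric x i j : Om x ->
  invmx (metric F x) i j = (h i x ^- 2) *+ (i == j).
Proof.
move=> Ox.
pose D : 'M[R]_n := diag_mx (\row_i (h i x ^- 2)).
have MD : D *m metric F x = 1%:M.
  apply/matrixP => a b; rewrite metric_h // mul_diag_mx !mxE.
  case: eqVneq => [->|_] /=; last by rewrite mulr0.
  by rewrite !mulr1n mulVf // expf_neq0 // h_neq0.
have [_ MU] := mulmx1_unit MD.
have -> : invmx (metric F x) = D by rewrite -[LHS]mul1mx -MD mulmxK.
by rewrite !mxE; case: eqVneq => [->|].
Qed.

Lemma smooth_h i : smooth Om (h i).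
Proof.
apply: smooth_sqrt => // [x Ox|]; first exact: h_gt0.
apply: (eq_smooth Om_open (f := fun x => mink (pd i F x) (pd i F x))).
  by move=> x Ox; rewrite mink_dF // eqxx.
by apply: smooth_mink => //; exact: smooth_dF.
Qed.

(** The Koszul identity for the diagonal metric of entries h_i^2. *)
Lemma mink_ddF i j l x : Om x ->
  mink (pd i (pd j F) x) (pd l F x) =
    (h j x * pd i (h j) x) *+ (j == l) + (h i x * pd j (h i) x) *+ (i == l)
    - (h i x * pd l (h i) x) *+ (i == j).
Proof.
move=> Ox.
have dg a b c : mink (pd a (pd b F) x) (pd c F x) + mink (pd a (pd c F) x) (pd b F x) =
    2 * ((h b x * pd a (h b) x) *+ (b == c)).
  have dF d : differentiable (pd d F) x by exact: smooth_differentiable (smooth_dF d) Ox.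
  have dh : differentiable (h b) x by exact: smooth_differentiable (smooth_h b) Ox.
  rewrite [X in _ + X]minkC -partial_mink //.
  rewrite (eq_partial Om_open (g := fun z => (h b z * h b z) *+ (b == c))) //; last first.
    by move=> z Oz; rewrite mink_dF // expr2.
  case: eqVneq => [_|_] /=; last by rewrite partial_cst mulr0.
  by rewrite partialM // !mulr1n; ring.
(* The product wanted is half of E1 + E2 - E3. *)
have E1 := dg i j l; have E2 := dg j i l; have E3 := dg l i j.
rewrite (ddFC j i Ox) in E2; rewrite (ddFC l i Ox) (ddFC l j Ox) in E3.
move: E1 E2 E3; move: (mink _ _) (mink _ _) (mink _ _) => A B C.
move: (_ *+ (j == l)) (_ *+ (i == l)) (_ *+ (i == j)) => a b c; lra.
Qed.

(** The Christoffel symbol with upper index l, defined as the coefficient of F_l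
    in the tangential part of F_ij; see [christoffelE]. *)
Definition Gamma l i j x : R := mink (pd i (pd j F) x) (pd l F x) * h l x ^- 2.

Lemma mink_ddF_Gamma i j l x : Om x ->
  mink (pd i (pd j F) x) (pd l F x) = Gamma l i j x * h l x ^+ 2.
Proof. by move=> Ox; rewrite /Gamma divfK // expf_neq0 // h_neq0. Qed.

Lemma smooth_Gamma l i j : smooth Om (Gamma l i j).
Proof.
apply: smoothM => //.
  by apply: smooth_mink => //; [exact: smooth_ddF | exact: smooth_dF].
apply: smoothV => // [|x Ox]; last by rewrite expf_neq0 // h_neq0.
have -> : (fun x => h l x ^+ 2) = (fun x => h l x * h l x).
  by apply/funext => x; rewrite expr2.
by apply: smoothM => //; exact: smooth_h.
Qed.

Lemma christoffelE l i j x : Om x -> christoffel (metric F) l i j x = Gamma l i j x.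
Proof.
move=> Ox.
have dF d : differentiable (pd d F) x by exact: smooth_differentiable (smooth_dF d) Ox.
have dg a b c : pd a (fun z => metric F z b c : R) x =
    mink (pd a (pd b F) x) (pd c F x) + mink (pd a (pd c F) x) (pd b F x).
  rewrite [X in _ = _ + X]minkC -partial_mink //; congr pd; apply/funext => z.
  exact: metricE.
rewrite /christoffel (bigD1 l) //= big1 => [|m ml]; last first.
  by rewrite invmx_metric // eq_sym (negbTE ml) mul0r.
rewrite addr0 invmx_metric // eqxx mulr1n !pdE !dg /Gamma.
rewrite (ddFC j i Ox) (ddFC l i Ox) (ddFC l j Ox).
by field; exact: h_neq0.
Qed.

(** The second fundamental form: the normal part of F_ij. *)
Definition sff i j x : 'cV[R]_(n + n) :=
  pd i (pd j F) x - \sum_p Gamma p i j x *: pd p F x.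

Lemma smooth_sff i j : smooth Om (sff i j).
Proof.
apply: (smoothD Om_open); first exact: smooth_ddF.
apply: (eq_smooth Om_open (f := fun x => \sum_p (- Gamma p i j x) *: pd p F x)).
  by move=> x _; rewrite -sumrN; apply: eq_bigr => p _; rewrite scaleNr.
apply: smooth_sum => // p; apply: smooth_scalemx => //; last exact: smooth_dF.
by apply: smoothN => //; exact: smooth_Gamma.
Qed.

Lemma mink_sum_dF (c : 'I_n -> R) l x : Om x ->
  mink (\sum_p c p *: pd p F x) (pd l F x) = c l * h l x ^+ 2.
Proof.
move=> Ox; rewrite mink_suml (bigD1 l) //= big1 => [|p pl]; last first.
  by rewrite minkZl mink_dF // (negbTE pl) mulr0.
by rewrite addr0 minkZl mink_dF // eqxx.
Qed.

Lemma sff_normal i j l x : Om x -> mink (sff i j x) (pd l F x) = 0.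
Proof. by move=> Ox; rewrite minkBl mink_sum_dF // mink_ddF_Gamma // subrr. Qed.

Lemma sff_mink i j x y : (forall l, mink (pd l F x) y = 0) ->
  mink (sff i j x) y = mink (pd i (pd j F) x) y.
Proof.
move=> yN; rewrite minkBl mink_suml big1 ?subr0 // => p _.
by rewrite minkZl yN mulr0.
Qed.

Lemma partial_sff k i j x : Om x -> pd k (sff i j) x =
  pd k (pd i (pd j F)) x - \sum_p (pd k (Gamma p i j) x *: pd p F x
                                   + Gamma p i j x *: pd k (pd p F) x).
Proof.
move=> Ox.
have dF d : differentiable (pd d F) x by exact: smooth_differentiable (smooth_dF d) Ox.
have ddF c d : differentiable (pd c (pd d F)) x.
  exact: smooth_differentiable (smooth_ddF c d) Ox.
have dG p : differentiable (Gamma p i j) x.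
  exact: smooth_differentiable (smooth_Gamma p i j) Ox.
have -> : sff i j = (fun z => pd i (pd j F) z +
    - (\sum_p (fun z => Gamma p i j z *: pd p F z)) z).
  by apply/funext => z; rewrite fct_sumE.
have dS p : differentiable (fun z => Gamma p i j z *: pd p F z) x.
  exact: differentiable_scalemx.
have dSum : differentiable (\sum_p (fun z => Gamma p i j z *: pd p F z)) x.
  exact: differentiable_sum.
rewrite partialD //; last exact: differentiableN.
rewrite partialN // partial_sum //; congr (_ - _); apply: eq_bigr => p _.
by rewrite partial_scalemx.
Qed.

Lemma tangent_partE x y k : Om x ->
  tangent_part F x y k 0 = mink (pd k F x) y * h k x ^- 2.
Proof.
move=> Ox; rewrite /tangent_part mxE (bigD1 k) //= big1 => [|l lk]; last first.
  by rewrite invmx_metric // eq_sym (negbTE lk) mul0r.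
rewrite addr0 invmx_metric // eqxx mulr1n gram_entry col_jac mulrC.
by congr (mink _ _ * _); apply/matrixP => a b; rewrite mxE ord1.
Qed.

Lemma normal_partE x y : Om x -> normal_part F x y =
  y - \sum_p (mink (pd p F x) y * h p x ^- 2) *: pd p F x.
Proof.
move=> Ox; congr (_ - _); apply/matrixP => a b; rewrite ord1 mxE summxE.
by apply: eq_bigr => p _; rewrite tangent_partE // !mxE pdE mulrC.
Qed.

Lemma normal_part_normal x y l : Om x -> mink (pd l F x) (normal_part F x y) = 0.
Proof.
move=> Ox; rewrite normal_partE // minkBr [X in _ - X]minkC mink_sum_dF //.
by rewrite divfK ?subrr // expf_neq0 // h_neq0.
Qed.

Lemma normal_part_id x y : Om x -> (forall l, mink (pd l F x) y = 0) ->
  normal_part F x y = y.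
Proof.
move=> Ox yN; rewrite normal_partE // big1 ?subr0 // => p _.
by rewrite yN mul0r scale0r.
Qed.

(** The normal parts of constant vectors are smooth normal fields, so that every
    normal vector at a point is the value of such a field. *)
Lemma normal_field_normal_part y : normal_field Om F (fun x => normal_part F x y).
Proof.
split; last by move=> x Ox i; rewrite pdE normal_part_normal.
apply: (eq_smooth Om_open (f := fun x =>
   y + \sum_p (- (mink (pd p F x) y * (h p x * h p x)^-1)) *: pd p F x)).
  move=> x Ox; rewrite normal_partE // -sumrN; congr (_ + _).
  by apply: eq_bigr => p _; rewrite expr2 scaleNr.
apply: smoothD => //; first exact: smooth_cst.
apply: smooth_sum => // p; apply: smooth_scalemx => //; last exact: smooth_dF.
apply: smoothN => //; apply: smoothM => //.
  by apply: smooth_mink => //; [exact: smooth_dF | exact: smooth_cst].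
apply: smoothV => // [|x Ox]; last by rewrite mulf_neq0 // h_neq0.
by apply: smoothM => //; exact: smooth_h.
Qed.

(** The form is non-degenerate on the normal space. *)
Lemma orthogonal_to_normals x w : Om x -> (forall l, mink (pd l F x) w = 0) ->
  (forall y, (forall l, mink (pd l F x) y = 0) -> mink w y = 0) -> w = 0.
Proof.
move=> Ox wN wT; apply: mink_nondegenerate => y.
have := wT _ (normal_part_normal y ^~ Ox).
rewrite normal_partE // minkBr mink_sumr big1 ?subr0 // => p _.
by rewrite minkZr [mink w _]minkC wN mulr0.
Qed.

Hypothesis coordinates : line_of_curvature_coordinates Om F v.
Hypothesis v_normal : forall x i, Om x -> forall l, mink (pd l F x) (v i x) = 0.

(** The second fundamental form is diagonal, with entries h_i^2 v_i: the shape
    operator of a normal field extending y has d/dx_i as an eigenvector with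
    eigenvalue (y, v_i). *)
Lemma mink_ddF_normal i j x y : Om x -> (forall l, mink (pd l F x) y = 0) ->
  mink (pd i (pd j F) x) y = (h i x ^+ 2 * mink (v i x) y) *+ (i == j).
Proof.
move=> Ox yN.
pose N x := normal_part F x y.
have NF : normal_field Om F N by exact: normal_field_normal_part.
have Nx : N x = y by exact: normal_part_id.
have dN : differentiable N x by exact: smooth_differentiable NF.1 Ox.
have dF d : differentiable (pd d F) x by exact: smooth_differentiable (smooth_dF d) Ox.
have /matrixP /(_ j 0) := coordinates Ox i NF.
rewrite mxE (bigD1 i) //= big1 => [|l li]; last first.
  by rewrite [delta_mx _ _ _ _]mxE (negbTE li) mulr0.
have shE : Defs.shape F N x j i = - (mink (pd j F x) (pd i N x) * h j x ^- 2).
  by rewrite mxE tangent_partE // pdE.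
rewrite shE [delta_mx i 0 i 0]mxE [RHS]mxE [delta_mx i 0 j 0]mxE.
rewrite !eqxx andbT mulr1 addr0 Nx [mink y _]minkC.
have : pd i (fun z => mink (pd j F z) (N z)) x = 0.
  rewrite (eq_partial Om_open i (g := cst 0)) ?partial_cst // => z Oz.
  exact: normal_part_normal.
rewrite partial_mink // Nx => /eqP; rewrite addr_eq0 => /eqP -> E.
have {}E : - mink (pd j F x) (pd i N x) = h j x ^+ 2 * (mink (v i x) y * (j == i)%:R).
  by rewrite -[j == i]andbT -E mulrN mulrC divfK // expf_neq0 // h_neq0.
rewrite E eq_sym; case: eqVneq => [->|_] /=; first by rewrite mulr1 mulr1n.
by rewrite !mulr0 mulr0n.
Qed.

Lemma sffE i j x : Om x -> sff i j x = (h i x ^+ 2 *+ (i == j)) *: v i x.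
Proof.
move=> Ox; apply/eqP; rewrite -subr_eq0; apply/eqP.
apply: (orthogonal_to_normals Ox) => [l|y yN].
  by rewrite minkBr minkC sff_normal // minkZr v_normal // mulr0 subrr.
rewrite minkBl sff_mink // mink_ddF_normal // minkZl.
by case: (i == j); rewrite ?mulr1n ?mulr0n ?mul0r subrr.
Qed.

Lemma partial_sff_off_diagonal k i j x : Om x -> i != j -> pd k (sff i j) x = 0.
Proof.
move=> Ox ij; rewrite (eq_partial Om_open k (g := cst 0)) ?partial_cst // => z Oz.
by rewrite sffE // (negbTE ij) mulr0n scale0r.
Qed.

(** The Gauss equation: the sectional curvature of the plane spanned by d/dx_i and
    d/dx_j is a multiple of (v_i, v_j), as the second fundamental form vanishes
    on the pair (d/dx_i, d/dx_j). *)
Lemma curvature_normals_orthogonal i j x : flat_metric Om (metric F) ->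
  Om x -> i != j -> mink (v i x) (v j x) = 0.
Proof.
move=> flat Ox ij.
have dF d : differentiable (pd d F) x by exact: smooth_differentiable (smooth_dF d) Ox.
have dS c d : differentiable (sff c d) x.
  exact: smooth_differentiable (smooth_sff c d) Ox.
have tangential k c d l : mink (pd k (sff c d) x) (pd l F x) =
    mink (pd k (pd c (pd d F)) x) (pd l F x)
    - (pd k (Gamma l c d) x + \sum_p Gamma p c d x * Gamma l k p x) * h l x ^+ 2.
  rewrite partial_sff // minkBl big_split /= minkDl mink_sum_dF // mink_suml.
  rewrite mulrDl mulr_suml; congr (_ - (_ + _)); apply: eq_bigr => p _.
  by rewrite minkZl mink_ddF_Gamma // mulrA.
have E1 : mink (pd i (sff j j) x) (pd i F x) = - mink (sff j j x) (pd i (pd i F) x).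
  apply/eqP; rewrite -addr_eq0 -partial_mink //.
  rewrite (eq_partial Om_open i (g := cst 0)) ?partial_cst // => z Oz.
  exact: sff_normal.
have E2 : mink (pd j (sff i j) x) (pd i F x) = 0.
  by rewrite partial_sff_off_diagonal // mink0l.
rewrite !tangential in E1 E2.
rewrite (partialC Om_open j i (smooth_dF j) Ox) in E2.
have := flat x Ox i j i j; rewrite /riemann !pdE.
rewrite (eq_partial Om_open i (christoffelE i j j) Ox).
rewrite (eq_partial Om_open j (christoffelE i i j) Ox).
under eq_bigr do rewrite !christoffelE //.
rewrite sumrB => flat0.
(* E1 - E2 equates the product with h_i^2 times the curvature component of
   flat0. *)
have E3 : mink (sff j j x) (pd i (pd i F) x) = 0.
  have h0 : h i x ^+ 2 != 0 by rewrite expf_neq0 // h_neq0.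
  move: E1 E2 flat0; nra.
move: E3; rewrite minkC mink_ddF_normal //; last by move=> l; rewrite minkC sff_normal.
rewrite sffE // !eqxx !mulr1n minkZr => /eqP.
by rewrite !mulf_eq0 !(negbTE (h_neq0 _ Ox)) => /eqP.
Qed.

Hypothesis h_normalised : forall x, Om x -> forall i,
  h i x ^+ 2 * `|mink (v i x) (v i x)| = 1.
Hypothesis v_last_timelike : forall x, Om x -> forall i, i.+1 = n ->
  mink (v i x) (v i x) < 0.
Hypothesis F_flat : flat_metric Om (metric F).

(** The frame vectors e_i, tangent to the curvature lines. *)
Definition tangent_dir i x := (h i x)^-1 *: pd i F x.

(** The frame vectors u_i, parallel to the curvature normals. *)
Definition normal_dir i x := h i x *: v i x.
Local Notation e := tangent_dir.
Local Notation u := normal_dir.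

Lemma smooth_tangent_dir i : smooth Om (e i).
Proof.
apply: smooth_scalemx => //; last exact: smooth_dF.
by apply: smoothV => // [|x Ox]; [exact: smooth_h | exact: h_neq0].
Qed.

Lemma smooth_normal_dir i : smooth Om (u i).
Proof.
apply: (eq_smooth Om_open (f := fun x => (h i x)^-1 *: sff i i x)).
  move=> x Ox; rewrite sffE // eqxx mulr1n scalerA expr2 mulrA mulVf ?mul1r //.
  exact: h_neq0.
apply: smooth_scalemx => //; last exact: smooth_sff.
by apply: smoothV => // [|x Ox]; [exact: smooth_h | exact: h_neq0].
Qed.

Lemma normal_dir_normal i l x : Om x -> mink (pd l F x) (u i x) = 0.
Proof. by move=> Ox; rewrite minkZr v_normal // mulr0. Qed.

Lemma mink_tangent_dir i j x : Om x -> mink (e i x) (e j x) = (i == j)%:R.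
Proof.
move=> Ox; rewrite minkZl minkZr mink_dF //; case: eqVneq => [->|_] /=.
  rewrite mulr1n; field; exact: h_neq0.
by rewrite mulr0n !mulr0.
Qed.

Lemma mink_tangent_normal i j x : Om x -> mink (e i x) (u j x) = 0.
Proof. by move=> Ox; rewrite minkZl normal_dir_normal // mulr0. Qed.

(** The u_i are orthonormal and the last one is time-like. *)
Lemma mink_normal_dir i j x : Om x -> mink (u i x) (u j x) = msign i *+ (i == j).
Proof.
move=> Ox.
have orth k l : k != l -> mink (u k x) (u l x) = 0.
  by move=> kl; rewrite minkZl minkZr (curvature_normals_orthogonal F_flat Ox kl) !mulr0.
case: eqVneq => [->|ij] /=; last exact: orth.
rewrite mulr1n.
have sq k : mink (u k x) (u k x) = h k x ^+ 2 * mink (v k x) (v k x).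
  by rewrite minkZl minkZr expr2 mulrA.
have hn k := h_normalised Ox k.
have last_neg k : k.+1 = n -> mink (u k x) (u k x) = -1.
  move=> kn; rewrite sq -(hn k) ltr0_norm; first by rewrite mulrN opprK.
  exact: v_last_timelike.
rewrite /msign; case: eqP => [|jn]; first exact: last_neg.
case: (ltrP (mink (v j x) (v j x)) 0) => vj.
  have uj : mink (u j x) (u j x) < 0.
    by rewrite sq pmulr_rlt0 // exprn_gt0 // h_gt0.
  have n1 : (n.-1 < n)%N by rewrite prednK.
  pose m := Ordinal n1.
  have mn : m.+1 = n by rewrite /= prednK.
  have um : mink (u m x) (u m x) < 0 by rewrite last_neg // oppr_lt0.
  have jm : j != m by apply/eqP => jm; apply: jn; rewrite jm.
  by have := timelike_not_orthogonal uj um; rewrite orth // eqxx.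
by rewrite sq -(hn j) ger0_norm.
Qed.

Lemma partial_tangent_dir j i x : Om x -> pd j (e i) x =
  - (pd j (h i) x * ((h i x)^-1 * (h i x)^-1)) *: pd i F x
  + (h i x)^-1 *: pd j (pd i F) x.
Proof.
move=> Ox.
have dF d : differentiable (pd d F) x by exact: smooth_differentiable (smooth_dF d) Ox.
have dh : differentiable (h i) x by exact: smooth_differentiable (smooth_h i) Ox.
have h0 := h_neq0 i Ox.
rewrite partial_scalemx // ?partialV //.
exact: differentiableV.
Qed.

Lemma xiE i j x : xi h x i j = if i == j then 0 else pd j (h i) x / h j x.
Proof. by rewrite mxE pdE. Qed.

(** The connection form of the orthonormal frame (e_i) of the induced metric. *)
Lemma mink_tangent_dtangent k j i x : Om x -> mink (e k x) (pd j (e i) x) =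
  xi h x j i *+ (j == k) - xi h x j k *+ (i == j).
Proof.
move=> Ox; rewrite partial_tangent_dir // minkDr minkZr minkZl minkZr minkZl.
have hi := h_neq0 i Ox; have hk := h_neq0 k Ox; have hj := h_neq0 j Ox.
rewrite mink_dF // [mink _ (pd j _ x)]minkC mink_ddF // !xiE.
rewrite [j == i]eq_sym [k == i]eq_sym.
case: (eqVneq i j) => [ij|ij]; last first.
  case: (eqVneq j k) => [jk|jk].
    by subst k; rewrite (negbTE ij) /= !mulr0n !mulr1n; field; rewrite ?hi ?hj.
  by case: (eqVneq i k) => [ik|ik]; rewrite /= ?mulr0n ?mulr1n;
    [subst k|]; field; rewrite ?hi ?hj ?hk.
subst j; case: (eqVneq i k) => [ik|ik]; rewrite /= ?mulr0n ?mulr1n;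
  [subst k|]; field; rewrite ?hi ?hk //.
Qed.

Lemma mink_normal_dtangent k j i x : Om x ->
  mink (u k x) (pd j (e i) x) = (msign k *+ (k == j)) *+ (i == j).
Proof.
move=> Ox; rewrite partial_tangent_dir // minkDr minkZr minkC normal_dir_normal //.
rewrite mulr0 add0r minkZr minkC mink_ddF_normal //; last first.
  by move=> l; exact: normal_dir_normal.
rewrite [i == j]eq_sym; case: (eqVneq j i) => [<-|_]; last by rewrite !mulr0n mulr0.
rewrite !mulr1n -(mink_normal_dir k _ Ox) [in RHS]minkC minkZl.
by field; exact: h_neq0.
Qed.

Lemma mink_tangent_dnormal k j i x : Om x ->
  mink (e k x) (pd j (u i) x) = - ((msign i *+ (i == j)) *+ (k == j)).
Proof.
move=> Ox.
have de : differentiable (e k) x by exact: smooth_differentiable (smooth_tangent_dir k) Ox.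
have du : differentiable (u i) x by exact: smooth_differentiable (smooth_normal_dir i) Ox.
apply/eqP; rewrite -addr_eq0 addrC -(mink_normal_dtangent i j k Ox) [mink (u i x) _]minkC.
rewrite -partial_mink //.
rewrite (eq_partial Om_open j (g := cst 0)) ?partial_cst // => z Oz.
exact: mink_tangent_normal.
Qed.

(** The Codazzi equation: differentiate the second fundamental form at (i, i) in
    the direction j, and at (i, j), where it vanishes, in the direction i. *)
Lemma mink_normal_dnormal_neq k j i x : Om x -> i != j ->
  mink (u k x) (pd j (u i) x) = xi h x i j * (msign j *+ (j == k)).
Proof.
move=> Ox ij.
have dF d : differentiable (pd d F) x by exact: smooth_differentiable (smooth_dF d) Ox.
have ddF c d : differentiable (pd c (pd d F)) x.
  exact: smooth_differentiable (smooth_ddF c d) Ox.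
have du : differentiable (u i) x by exact: smooth_differentiable (smooth_normal_dir i) Ox.
have dh : differentiable (h i) x by exact: smooth_differentiable (smooth_h i) Ox.
have uN l : mink (pd l F x) (u k x) = 0 by exact: normal_dir_normal.
have hi := h_neq0 i Ox; have hj := h_neq0 j Ox.
have normal_component m c d : mink (pd m (sff c d) x) (u k x) =
    mink (pd m (pd c (pd d F)) x) (u k x)
    - Gamma m c d x * (h m x * mink (u m x) (u k x)).
  rewrite partial_sff // minkBl mink_suml (bigD1 m) //= big1 ?addr0.
    rewrite minkDl !minkZl uN mulr0 add0r mink_ddF_normal // eqxx mulr1n.
    by rewrite expr2 -mulrA.
  move=> p pm; rewrite minkDl !minkZl uN mulr0 add0r mink_ddF_normal //.
  by rewrite eq_sym (negbTE pm) mulr0n mulr0.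
have E1 := normal_component i i j; have E2 := normal_component j i i.
rewrite partial_sff_off_diagonal // mink0l in E1.
have E3 : pd j (pd i (pd i F)) x = pd i (pd i (pd j F)) x.
  rewrite (partialC Om_open j i (smooth_dF i) Ox).
  by apply: (eq_partial Om_open) Ox => z Oz; exact: ddFC.
have E4 : pd j (sff i i) x = pd j (h i) x *: u i x + h i x *: pd j (u i) x.
  rewrite -partial_scalemx //; apply: (eq_partial Om_open) Ox => z Oz.
  by rewrite sffE // eqxx mulr1n scalerA expr2.
rewrite E3 E4 minkDl (minkZl (pd j (h i) x)) (minkZl (h i x) (pd j (u i) x)) in E2.
have Gij : Gamma i i j x = pd j (h i) x / h i x.
  rewrite /Gamma mink_ddF // eqxx [j == i]eq_sym (negbTE ij) !mulr0n mulr1n.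
  by field.
have Gii : Gamma j i i x = - (h i x * pd j (h i) x) / h j x ^+ 2.
  by rewrite /Gamma mink_ddF // eqxx (negbTE ij) !mulr0n mulr1n add0r sub0r.
rewrite xiE (negbTE ij) -(mink_normal_dir j k Ox).
apply: (mulfI hi); apply: (addrI (pd j (h i) x * mink (u i x) (u k x))).
rewrite [mink (u k x) (pd j _ x)]minkC E2; move/eqP: E1; rewrite eq_sym subr_eq0 => /eqP ->.
by rewrite Gij Gii; field; exact/andP.
Qed.

(** The case i = j follows from the other one, as the products of the u_i are
    constant. *)
Lemma mink_normal_dnormal k j i x : Om x -> mink (u k x) (pd j (u i) x) =
  msign j * (xi h x i j *+ (j == k)) - msign j * (xi h x k j *+ (i == j)).
Proof.
move=> Ox; case: (eqVneq i j) => [->|ij]; last first.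
  by rewrite mink_normal_dnormal_neq // mulr0n mulr0 subr0 !mulrnAr mulrC.
rewrite [xi _ _ j j]xiE eqxx mul0rn mulr0 sub0r mulr1n.
have du c : differentiable (u c) x by exact: smooth_differentiable (smooth_normal_dir c) Ox.
have skew c : mink (pd j (u c) x) (u j x) + mink (u c x) (pd j (u j) x) = 0.
  rewrite -partial_mink //.
  rewrite (eq_partial Om_open j (g := cst (msign c *+ (c == j)))) ?partial_cst //.
  by move=> z Oz; rewrite mink_normal_dir.
have /eqP := skew k; rewrite addrC addr_eq0 => /eqP ->; congr (- _).
case: (eqVneq k j) => [->|kj].
  rewrite xiE eqxx mulr0; have := skew j; rewrite minkC => E.
  by move: E; lra.
by rewrite minkC mink_normal_dnormal_neq // eqxx mulr1n mulrC.
Qed.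

Local Notation Psi := (frame F h v).
Local Notation theta j x := (connection j (Xi h x)).

Lemma col_frame_l i x : col (lshift n i) (Psi x) = e i x.
Proof. by apply/matrixP => a b; rewrite ord1 mxE row_mxEl mxE pdE. Qed.

Lemma col_frame_r i x : col (rshift n i) (Psi x) = u i x.
Proof. by apply/matrixP => a b; rewrite ord1 mxE row_mxEr mxE. Qed.

Lemma smooth_frame : smooth Om Psi.
Proof.
apply: smooth_col => // j; case: (split_ordP j) => i ->.
  apply: (eq_smooth Om_open (f := e i)) => [x _|]; first by rewrite col_frame_l.
  exact: smooth_tangent_dir.
apply: (eq_smooth Om_open (f := u i)) => [x _|]; first by rewrite col_frame_r.
exact: smooth_normal_dir.
Qed.

Lemma frame_lorentz x : Om x -> lorentz_group (Psi x).
Proof.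
move=> Ox; apply/matrixP => a b; rewrite gram_entry Im_double //.
case: (split_ordP a) => i ->; case: (split_ordP b) => j ->;
  rewrite ?col_frame_l ?col_frame_r.
- by rewrite block_mxEul mink_tangent_dir // mxE.
- by rewrite block_mxEur mink_tangent_normal // mxE.
- by rewrite block_mxEdl minkC mink_tangent_normal // mxE.
- by rewrite block_mxEdr mink_normal_dir // Imink_entry.
Qed.

Lemma delta_mul_entry (A : 'M[R]_n) i k l : (delta_mx i i *m A) k l = A i l *+ (k == i).
Proof.
rewrite mxE (bigD1 i) //= big1 => [|m mi]; last by rewrite mxE (negbTE mi) andbF mul0r.
by rewrite addr0 mxE eqxx andbT; case: (k == i); rewrite ?mul1r ?mul0r.
Qed.

Lemma mul_delta_entry (A : 'M[R]_n) i k l : (A *m delta_mx i i) k l = A k i *+ (l == i).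
Proof.
rewrite mxE (bigD1 i) //= big1 => [|m mi]; last by rewrite mxE (negbTE mi) mulr0.
by rewrite addr0 mxE eqxx /=; case: (l == i); rewrite ?mulr1 ?mulr0.
Qed.

(** The structure equations of the frame, in matrix form. *)
Lemma partial_frame j x : Om x -> pd j Psi x = Psi x *m theta j x.
Proof.
move=> Ox.
have dPsi : differentiable Psi x by exact: smooth_differentiable smooth_frame Ox.
have PL := frame_lorentz Ox.
(* It suffices to compare the products with the columns of the frame. *)
suff E : (Psi x)^T *m Imink R (n + n) *m pd j Psi x = Imink R (n + n) *m theta j x.
  rewrite -[LHS]mul1mx -(lorentz_right_inverse PL) -!mulmxA.
  by rewrite [(Psi x)^T *m _]mulmxA E mul_ImK.
have colE a : col a (pd j Psi x) = pd j (fun z => col a (Psi z)) x by exact: partial_col.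
have col_l i : (fun z => col (lshift n i) (Psi z)) = e i.
  by apply/funext => z; rewrite col_frame_l.
have col_r i : (fun z => col (rshift n i) (Psi z)) = u i.
  by apply/funext => z; rewrite col_frame_r.
rewrite /connection lie_a_basis_Xi /a_basis add_block_mx !add0r !addr0.
rewrite [in RHS]Im_double //.
rewrite mulmx_block !(mul0mx, mul1mx, add0r, addr0).
apply/matrixP => a b; rewrite gram_entry colE.
case: (split_ordP a) => k ->; case: (split_ordP b) => i ->;
  rewrite ?col_frame_l ?col_frame_r ?col_l ?col_r.
- rewrite block_mxEul mink_tangent_dtangent //.
  rewrite [RHS]mxE [X in _ = _ + X]mxE delta_mul_entry mul_delta_entry [_^T _ _]mxE.
  by rewrite [j == k]eq_sym.
- rewrite block_mxEur mink_tangent_dnormal //.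
  rewrite [RHS]mxE delta_mul_entry Imink_entry; congr (- (_ *+ _)).
  by rewrite eq_sym; case: eqVneq => [->|].
- rewrite block_mxEdl mink_normal_dtangent // mulIm_entry mxE.
  by case: (k == j); case: (i == j); rewrite /= ?mulr1 ?mulr0.
- rewrite block_mxEdr mink_normal_dnormal // mulIm_entry.
  rewrite [X in _ = _ * X]mxE delta_mul_entry [_^T _ _]mxE.
  rewrite [X in _ = _ * (_ + X)]mxE mul_Imink_entry mul_delta_entry mulIm_entry.
  have sk := msign_sqr (R := R) k; have sj := msign_sqr (R := R) j.
  rewrite [j == k]eq_sym; case: (eqVneq k j) => [->|_]; case: (eqVneq i j) => [->|_];
    rewrite /= ?mulr1n ?mulr0n; ring: sk sj.
Qed.

Lemma frame_solves_log_derivative :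
  solves_log_derivative Om Psi (fun i x => a_basis R i + lie (a_basis R i) (Xi h x)).
Proof.
move=> x Ox; have PU := lorentz_unitmx (frame_lorentz Ox).
have dPsi : differentiable Psi x by exact: smooth_differentiable smooth_frame Ox.
split=> // w; rewrite diff_partial // mulmx_sumr; apply: eq_bigr => i _.
by rewrite -scalemxAr partial_frame // mulKmx.
Qed.

Lemma smooth_xi i j : smooth Om (fun x => xi h x i j : R).
Proof.
case: (eqVneq i j) => [->|ij].
  by apply: (eq_smooth Om_open (f := cst 0)) (smooth_cst Om_open 0) => x _; rewrite xiE eqxx.
apply: (eq_smooth Om_open (f := fun x => pd j (h i) x * (h j x)^-1)).
  by move=> x _; rewrite xiE (negbTE ij).
apply: smoothM => //; first by apply: smooth_partial; exact: smooth_h.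
by apply: smoothV => // [|x Ox]; [exact: smooth_h | exact: h_neq0].
Qed.

Lemma smooth_Xi : smooth Om (Xi h).
Proof.
apply/(smooth_mxP Om_open) => a b.
case: (split_ordP a) => i ->; case: (split_ordP b) => j ->.
- apply: (eq_smooth Om_open (f := cst 0)) (smooth_cst Om_open 0) => x _.
  by rewrite block_mxEul mxE.
- by apply: (eq_smooth Om_open) (smooth_xi j i) => x _; rewrite block_mxEur [RHS]mxE.
- apply: (eq_smooth Om_open (f := fun x => - msign i * xi h x i j)).
    by move=> x _; rewrite block_mxEdl [RHS]mxE mulIm_entry mulNr.
  by apply: smoothM => //; [exact: smooth_cst | exact: smooth_xi].
- apply: (eq_smooth Om_open (f := cst 0)) (smooth_cst Om_open 0) => x _.
  by rewrite block_mxEdr mxE.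
Qed.

Lemma partial_connection i j x : Om x ->
  differentiable (fun z => theta j z) x /\
  pd i (fun z => theta j z) x = lie (a_basis R j) (pd i (Xi h) x).
Proof.
move=> Ox.
have dX : differentiable (Xi h) x by exact: smooth_differentiable smooth_Xi Ox.
have dc : differentiable (cst (a_basis R j) : 'cV[R]_n -> _) x by [].
have d1 := differentiable_mulmx dc dX; have d2 := differentiable_mulmx dX dc.
have d3 : differentiable (fun z => - (Xi h z *m a_basis R j)) x.
  exact: differentiableN.
have d4 : differentiable (fun z => lie (a_basis R j) (Xi h z)) x.
  exact: differentiableD.
split; first exact: differentiableD.
rewrite /connection partialD // [X in X + _]partial_cst add0r.
rewrite /lie partialD // partialN // (partial_mulmx i dc dX) (partial_mulmx i dX dc).
by rewrite [pd i (cst _) x]partial_cst mul0mx mulmx0 add0r addr0.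
Qed.

(** The integrability condition of the structure equations. *)
Lemma Xi_UK_equation i j x : Om x -> i != j ->
  lie (a_basis R i) (pd j (Xi h) x) - lie (a_basis R j) (pd i (Xi h) x)
  - lie (lie (a_basis R i) (Xi h x)) (lie (a_basis R j) (Xi h x)) = 0.
Proof.
move=> Ox ij.
have dPsi : differentiable Psi x by exact: smooth_differentiable smooth_frame Ox.
have second k l : pd k (pd l Psi) x =
    Psi x *m (theta k x *m theta l x + lie (a_basis R l) (pd k (Xi h) x)).
  have [dth pth] := partial_connection k l Ox.
  rewrite (eq_partial Om_open k (g := fun z => Psi z *m theta l z)) //; last first.
    by move=> z Oz; exact: partial_frame.
  by rewrite (partial_mulmx k dPsi dth) pth partial_frame // mulmxDr mulmxA.
have := partialC Om_open i j smooth_frame Ox; rewrite !second.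
move=> /(can_inj (mulKmx (lorentz_unitmx (frame_lorentz Ox)))) E.
rewrite -connection_bracket // /lie.
move: E; rewrite /lie; move: (theta i x *m theta j x) (theta j x *m theta i x) => p q.
move: (_ - _) (_ - _) => r s E; apply/eqP; rewrite subr_eq0; apply/eqP.
have -> : r = p + s - q by rewrite E [q + r]addrC addrK.
by apply/matrixP => k l; rewrite !mxE; ring.
Qed.

Lemma UK_solution_Xi : UK_solution Om (Xi h).
Proof.
split; first exact: smooth_Xi.
  by move=> x _; split; [exact: Xi_p_space | exact: Xi_a_perp].
by move=> x Ox i j ij; rewrite !pdE; exact: Xi_UK_equation.
Qed.

Hypothesis F_lightcone : forall x, Om x -> mink (F x) (F x) = 0.

(** The derivative of (F, F) = 0. *)
Lemma position_normal i x : Om x -> mink (pd i F x) (F x) = 0.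
Proof.
move=> Ox; have dF : differentiable F x by exact: smooth_differentiable F_smooth Ox.
have : pd i (fun z => mink (F z) (F z)) x = 0.
  by rewrite (eq_partial Om_open i (g := cst 0)) ?partial_cst.
by rewrite partial_mink // [X in _ + X]minkC; lra.
Qed.

(** The co-ordinates of F in the frame; by [frame_lorentz] the inverse of the
    frame is I Psi^T I. *)
Definition frame_coord x : 'cV[R]_(n + n) :=
  Imink R (n + n) *m ((Psi x)^T *m Imink R (n + n) *m F x).
Local Notation y := frame_coord.

Lemma frame_coordK x : Om x -> Psi x *m y x = F x.
Proof.
move=> Ox; rewrite /frame_coord !mulmxA -[RHS]mul1mx.
by rewrite -(lorentz_right_inverse (frame_lorentz Ox)) !mulmxA.
Qed.

Lemma smooth_frame_coord : smooth Om y.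
Proof.
have sI : smooth Om (cst (Imink R (n + n)) : 'cV[R]_n -> _) by exact: smooth_cst.
apply: (smooth_mulmx Om_open sI); apply: (smooth_mulmx Om_open _ F_smooth).
by apply: (smooth_mulmx Om_open _ sI); apply: smooth_trmx => //; exact: smooth_frame.
Qed.

Lemma usubmx_frame_coord x : Om x -> usubmx (y x) = 0.
Proof.
move=> Ox; apply/matrixP => i j; rewrite mxE mulIm_entry gram_entry col_frame_l.
rewrite [RHS]mxE (_ : col j (F x) = F x); last by apply/matrixP => a b; rewrite mxE !ord1.
by rewrite minkZl position_normal // !mulr0.
Qed.

Lemma frame_coordE x : Om x -> y x = col_mx 0 (dsubmx (y x)).
Proof. by move=> Ox; rewrite -{1}[y x]vsubmxK usubmx_frame_coord. Qed.

(** The column y of co-ordinates of F is parallel for the connection with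
    coefficients [a_i, Xi]: since dF is tangent, F_i = h_i e_i, and y has no
    tangential half, the left-hand side has no tangential half, and it equals
    h_i times a unit vector minus a_i y, which has no normal half. *)
Lemma parallel_frame_coord i x : Om x ->
  lie (a_basis R i) (Xi h x) *m y x + pd i y x = 0.
Proof.
move=> Ox.
have dPsi : differentiable Psi x by exact: smooth_differentiable smooth_frame Ox.
have dy : differentiable y x by exact: smooth_differentiable smooth_frame_coord Ox.
set z := _ + _.
have zE : z = h i x *: delta_mx (lshift n i) 0 - a_basis R i *m y x.
  have dFE : pd i F x = Psi x *m (h i x *: delta_mx (lshift n i) 0).
    rewrite -scalemxAr -colE col_frame_l scalerA mulfV ?scale1r //.
    exact: h_neq0.
  have : pd i F x = Psi x *m (theta i x *m y x + pd i y x).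
    rewrite (eq_partial Om_open i (g := fun z => Psi z *m y z)) //; last first.
      by move=> w Ow; rewrite frame_coordK.
    by rewrite (partial_mulmx i dPsi dy) partial_frame // mulmxDr mulmxA.
  rewrite dFE => /(can_inj (mulKmx (lorentz_unitmx (frame_lorentz Ox)))) ->.
  by rewrite /connection mulmxDl -(addrA (a_basis R i *m y x)) -/z addrAC subrr add0r.
rewrite -[z]vsubmxK -col_mx0; congr col_mx.
  rewrite /z linearD /= frame_coordE // lie_a_basis_Xi mul_block_col.
  rewrite !(mul0mx, mulmx0, add0r, addr0) col_mxKu add0r.
  apply/matrixP => a b; rewrite !mxE (partial_mx i _ _ dy).
  rewrite (eq_partial Om_open i (g := cst 0)) ?partial_cst // => w Ow.
  by have /matrixP /(_ a b) := usubmx_frame_coord Ow; rewrite !mxE.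
rewrite zE frame_coordE // mul_block_col !(mul0mx, mulmx0, add0r, addr0).
rewrite linearB /= col_mxKd subr0; apply/matrixP => a b.
by rewrite !mxE eq_rlshift /= mulr0.
Qed.

Lemma position_constant (g1 g2 : 'cV[R]_n -> 'M[R]_n) :
  Om !=set0 -> connected Om ->
  (forall x, Om x -> orthogonal_group (g1 x) /\ lorentz_group (g2 x)) ->
  solves_log_derivative Om (fun x => block_mx (g1 x) 0 0 (g2 x))
    (fun i x => lie (a_basis R i) (Xi h x)) ->
  exists c : 'cV[R]_n, [/\ c != 0, mink c c = 0 &
    forall x, Om x -> F x = Psi x *m col_mx 0 (invmx (g2 x) *m c)].
Proof.
move=> [x0 Ox0] cOm gK gsol.
pose g x := block_mx (g1 x) 0 0 (g2 x).
have dy x : Om x -> differentiable y x by exact: smooth_differentiable smooth_frame_coord.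
have dg x : Om x -> differentiable g x by move=> /gsol [].
have pg i x : Om x -> pd i g x = g x *m lie (a_basis R i) (Xi h x).
  move=> Ox; have [gU _ /(_ (delta_mx i 0))] := gsol x Ox.
  rewrite -/g -(partialE i (dg x Ox)) (bigD1 i) //= big1 => [|j ji]; last first.
    by rewrite mxE (negbTE ji) scale0r.
  by rewrite mxE !eqxx scale1r addr0 => <-; rewrite mulKVmx.
have dgy x : Om x -> differentiable (fun z => g z *m y z) x.
  by move=> Ox; apply: differentiable_mulmx; [exact: dg | exact: dy].
have pgy x i : Om x -> pd i (fun z => g z *m y z) x = 0.
  move=> Ox; rewrite (partial_mulmx i (dg x Ox) (dy x Ox)) pg // -mulmxA -mulmxDr.
  by rewrite parallel_frame_coord // mulmx0.
have const := constant_on_connected Om_open cOm dgy pgy.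
have gyE x : Om x -> g x *m y x = col_mx 0 (g2 x *m dsubmx (y x)).
  by move=> Ox; rewrite {1}frame_coordE // mul_block_col !(mul0mx, mulmx0, add0r).
pose c := g2 x0 *m dsubmx (y x0).
have gc x : Om x -> g2 x *m dsubmx (y x) = c.
  by move=> Ox; have := const x x0 Ox Ox0; rewrite !gyE // => /eq_col_mx[].
have yc x : Om x -> dsubmx (y x) = invmx (g2 x) *m c.
  by move=> Ox; rewrite -(gc x Ox) mulKmx //; apply: lorentz_unitmx; exact: (gK x Ox).2.
have Fc x : Om x -> F x = Psi x *m col_mx 0 (invmx (g2 x) *m c).
  by move=> Ox; rewrite -yc // -frame_coordE // frame_coordK.
exists c; split=> //.
  apply: contra_eq_neq (erefl c) => c0.
  (* If c were zero then F would vanish, although its derivatives do not. *)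
have F0 x : Om x -> F x = 0 by move=> /Fc ->; rewrite c0 mulmx0 col_mx0 mulmx0.
  pose i := Ordinal n_gt0.
  have := mink_dF i i Ox0; rewrite (eq_partial Om_open i F0 Ox0) partial_cst mink0l.
  move=> /esym/eqP; rewrite eqxx mulr1n expf_eq0 /= => E.
  by have := h_neq0 i Ox0; rewrite E.
rewrite /c mink_lorentz; last exact: (gK x0 Ox0).2.
rewrite -mink_col_mx0 // -frame_coordE // -(mink_lorentz _ _ (frame_lorentz Ox0)).
by rewrite frame_coordK // F_lightcone.
Qed.

End Immersion.

Unset Implicit Arguments.

Theorem theorem3p1 (R : realType) (n : nat) (n_gt0 : (0 < n)%N)
    (Om : set 'cV[R]_n)
    (F : 'cV[R]_n -> 'cV[R]_(n + n))
    (v : 'I_n -> 'cV[R]_n -> 'cV[R]_(n + n))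
    (h : 'I_n -> 'cV[R]_n -> R)
    (Om_open : open Om) (Om_nonempty : Om !=set0) (Om_connected : connected Om)
    (F_smooth : smooth Om F)
    (F_lightcone : forall x, Om x -> mink (F x) (F x) = 0)
    (F_flat : flat_immersion Om F)
    (F_flat_normal : flat_normal_bundle Om F)
    (F_nondegenerate : nondegenerate_normal_bundle Om F)
    (v_curvature_normals : curvature_normals Om F v)
    (v_last_timelike :
       forall x, Om x -> forall i : 'I_n, i.+1 = n ->
         mink (v i x) (v i x) < 0)
    (coordinates : line_of_curvature_coordinates Om F v)
    (h_gt0 : forall x, Om x -> forall i, 0 < h i x)
    (metric_h : forall x, Om x ->
       metric F x = diag_mx (\row_i (h i x ^+ 2)))
    (h_normalised : forall x, Om x -> forall i,
       h i x ^+ 2 * `|mink (v i x) (v i x)| = 1) :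
  [/\ (forall x, Om x -> lorentz_group (frame F h v x)),
      UK_solution Om (Xi h),
      solves_log_derivative Om (frame F h v)
        (fun i x => a_basis R i + lie (a_basis R i) (Xi h x)) &
      forall g1 g2 : 'cV[R]_n -> 'M[R]_n,
        (forall x, Om x ->
           orthogonal_group (g1 x) /\ lorentz_group (g2 x)) ->
        solves_log_derivative Om (fun x => block_mx (g1 x) 0 0 (g2 x))
          (fun i x => lie (a_basis R i) (Xi h x)) ->
        exists c : 'cV[R]_n,
          [/\ c != 0, mink c c = 0 &
              forall x, Om x ->
                F x = frame F h v x *m col_mx 0 (invmx (g2 x) *m c)]].
Proof.
have v_normal x i : Om x -> forall l, mink (pd l F x) (v i x) = 0.
  by move=> Ox l; have := (v_curvature_normals x Ox i).1 l; rewrite pdE.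
have flat := F_flat.2.
split.
- by move=> x Ox; exact: (frame_lorentz n_gt0 Om_open).
- exact: (UK_solution_Xi n_gt0 Om_open F_smooth h_gt0 metric_h coordinates v_normal).
- exact: (frame_solves_log_derivative n_gt0 Om_open).
- by move=> g1 g2; exact: (position_constant n_gt0 Om_open).
Qed.
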